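(* Let $\mathcal G$ be a locally finite $\Gamma$-periodic graph with fundamental graph $\mathcal G_*=(\mathcal V_*,\mathcal A_* )$, $\nu=\#\mathcal V_*$, let $V$ be a real $\Gamma$-periodic potential, and let $H(k)=A(k)-\varkappa+V$, $k\in\mathbb T^d$, be the fiber Schrödinger operator on $\ell^2(\mathcal V_* )$. Then for $t\in\mathbb C$: $$\operatorname{Tr}e^{tH(k)}=\nu+\sum_{n=1}^\infty\frac{t^n}{n!}\,\mathcal T_n(k)=\nu+\sum_{\mathbf c\in\widetilde{\mathcal C}}\frac{\omega(\mathbf c)}{|\mathbf c|!}\,t^{|\mathbf c|}\cos\langle\tau(\mathbf c),k\rangle,$$ $$\operatorname{Tr}e^{tH(k)}=\nu+\sum_{\mathrm m\in\mathbb Z^d}\mathfrak h_{\mathrm m}(t)\cos\langle\mathrm m,k\rangle,\qquad \mathfrak h_{\mathrm m}(t)=\sum_{\mathbf c\in\widetilde{\mathcal C}^{\mathrm m}}\frac{\omega(\mathbf c)}{|\mathbf c|!}\,t^{|\mathbf c|},$$ $$\frac1{(2\pi)^d}\int_{\mathbb T^d}\operatorname{Tr}e^{tH(k)}\,dk=\nu+\sum_{n=1}^\infty\frac{t^n}{n!}\,\mathcal T_{n,0}=\nu+\sum_{\mathbf c\in\widetilde{\mathcal C}^0}\frac{\omega(\mathbf c)}{|\mathbf c|!}\,t^{|\mathbf c|},$$ where $\mathcal T_n(k)=\sum_{\mathbf c\in\widetilde{\mathcal C}_n}\omega(\mathbf c)\cos\langle\tau(\mathbf c),k\rangle$ and $\mathcal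 T_{n,0}=\sum_{\mathbf c\in\widetilde{\mathcal C}_n^0}\omega(\mathbf c)$. All these series converge absolutely for all $t\in\mathbb C$.
   Context: Periodic graph. $\mathcal G=(\mathcal V,\mathcal E)$ is a connected infinite graph, possibly having loops and multiple edges, embedded into $\mathbb R^d$; $\mathcal V$ is its vertex set, $\mathcal E$ its set of unoriented edges. Each edge in $\mathcal E$ has two orientations, and $\mathcal A$ is the set of all oriented edges. An oriented edge starting at $x$ and ending at $y$ is denoted $(x,y)$ (several edges may have the same end points). The degree $\varkappa_x$ is the number of edges of $\mathcal A$ starting at $x$. $\Gamma\subset\mathbb R^d$ is a lattice of rank $d$ with basis $a_1,\dots,a_d$. The graph is locally finite and $\Gamma$-periodic: $\mathcal G+a=\mathcal G$ for all $a\in\Gamma$, and the quotient (fundamental) graph $\mathcal G_*=\mathcal G/\Gamma=(\mathcal V_*,\mathcal A_* )$ with $\mathcal V_*=\mathcal V/\Gamma$, $\mathcal A_*=\mathcal A/\Gamma$ is finite. Edge index. Let $\Omega=\{\sum_s t_sa_s:\ t_s\in[0,1)\}$. Each $x\in\mathcal V$ is uniquely $x=x_0+[x]$ with $x_0\in\Omega$, $[x]\in\Gamma$; $[x]_{\mathbb A}\in\mathbb Z^d$ is the coordinate vector of $[x]$ in the basis $a_1,\dots,a_d$. For $\mathbf e=(x,y)\in\mathcal A$ put $\tau(\mathbf e)=[y]_{\mathbb A}-[x]_{\mathbb A}\in\mathbb Z^d$. This is $\Gamma$-invariant, so it induces the index $\tau(\mathbf e)$ for $\mathbf e\in\mathcal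 A_*$. Operators. $V$ is a real function on $\mathcal V$ with $V_{x+a}=V_x$ for $a\in\Gamma$; $V$ and $\varkappa$ are regarded also as functions (diagonal operators) on $\mathcal V_*$. With $\mathbb T^d=\mathbb R^d/(2\pi\mathbb Z)^d$: $(A(k)f)_x=\sum_{\mathbf e=(x,y)\in\mathcal A_*}e^{i\langle\tau(\mathbf e),k\rangle}f_y$ and $H(k)=A(k)-\varkappa+V$ on $\ell^2(\mathcal V_* )=\mathbb C^\nu$. Modified graph and cycles. $\widetilde{\mathcal G}_*=(\mathcal V_*,\widetilde{\mathcal A}_* )$ is obtained by adding at each $x\in\mathcal V_*$ one loop $\mathbf e_x$ (a single element of $\widetilde{\mathcal A}_*$, its own inverse): $\widetilde{\mathcal A}_*=\mathcal A_*\cup\{\mathbf e_x\}_{x\in\mathcal V_*}$, $\tau(\mathbf e_x)=0$. A cycle of length $|\mathbf c|=n\geq1$ is a sequence $\mathbf c=(\mathbf e_1,\dots,\mathbf e_n)$ of oriented edges $\mathbf e_j=(x_j,x_{j+1})$, $x_{n+1}=x_1$ (a closed walk; the starting point and direction matter, and backtracking is allowed); its index is $\tau(\mathbf c)=\sum_j\tau(\mathbf e_j)$. $\widetilde{\mathcal C}$ is the set of all cycles in $\widetilde{\mathcal G}_*$; $\widetilde{\mathcal C}_n$ those of length $n$; $\widetilde{\mathcal C}^{\mathrm m}$ those of index $\mathrm m\in\mathbb Z^d$; $\widetilde{\mathcal C}_n^{\mathrm m}=\widetilde{\mathcal C}_n\cap\widetilde{\mathcal C}^{\mathrm m}$. Edge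 weights: $\omega(\mathbf e)=1$ for $\mathbf e\in\mathcal A_*$, $\omega(\mathbf e_x)=V_x-\varkappa_x$; $\omega(\mathbf c)=\omega(\mathbf e_1)\cdots\omega(\mathbf e_n)$. *)

(* Defs.v *)
From HB Require Import structures.
From mathcomp Require Import all_boot all_order all_algebra finmap.
From mathcomp Require Import complex.
From mathcomp Require Import all_classical all_reals all_analysis.
From mathcomp.analysis.showcase Require summability.

Set Implicit Arguments.
Unset Strict Implicit.
Unset Printing Implicit Defensive.

Import Order.TTheory GRing.Theory Num.Theory numFieldNormedType.Exports.

Local Open Scope classical_set_scope.
Local Open Scope ring_scope.
Local Open Scope complex_scope.

(* MathComp-Analysis puts a topology on every [numClosedFieldType], but the
   inference does not start from the bare type [R[i]]; hence this alias. *)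
Definition Cplx (R : realType) : numClosedFieldType := R[i].

Definition expi {R : realType} (x : R) : Cplx R := cos x +i* sin x.

Definition mexp {R : realType} {n : nat} (A : 'M[Cplx R]_n) : 'M[Cplx R]_n :=
  limn (series (fun j : nat => (j`!%:R)^-1 *: A ^+ j)).

(* The library's norm on [R[i]] has values in [R[i]], [normc] has values in [R]. *)
Definition abs_summable {R : realType} {I : choiceType} (D : set I)
    (f : I -> Cplx R) : Prop :=
  summable D (fun i => (Normc.normc (f i))%:E).

(* Unordered sum over [D]: the limit of the finite partial sums along the
   finite sets of indices directed by inclusion. *)
Definition sum_over {R : realType} {I : choiceType} (D : set I)
    (f : I -> Cplx R) : Cplx R :=
  summability.sum (patch (fun=> 0) D f).

Section lebesgue_tuple.
Context {R : realType}.
Local Notation RR := (measurableTypeR R).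

Section cons_measure.
Context {n : nat} (mu : {sigma_finite_measure set (n.-tuple RR) -> \bar R}).

Definition tuple_cons (p : RR * n.-tuple RR) : n.+1.-tuple RR :=
  [tuple of p.1 :: p.2].

Lemma measurable_tuple_cons : measurable_fun [set: RR * n.-tuple RR] tuple_cons.
Proof. by apply: measurable_cons; [exact: measurable_fst|exact: measurable_snd]. Qed.

HB.instance Definition _ :=
  isMeasurableFun.Build _ _ _ _ tuple_cons measurable_tuple_cons.

Definition cons_measure : set (n.+1.-tuple RR) -> \bar R :=
  pushforward ((@lebesgue_measure R) \x mu)%E tuple_cons.

Let cons_measure0 : cons_measure set0 = 0%E.
Proof. exact: measure0. Qed.

Let cons_measure_ge0 A : (0 <= cons_measure A)%E.
Proof. exact: measure_ge0. Qed.

Let cons_measure_sigma_additive : semi_sigma_additive cons_measure.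
Proof. exact: measure_semi_sigma_additive. Qed.

HB.instance Definition _ := isMeasure.Build _ _ _ cons_measure
  cons_measure0 cons_measure_ge0 cons_measure_sigma_additive.

Lemma cons_measure_sigma_finite : sigma_finite setT cons_measure.
Proof.
have /sigma_finiteP[F [UF ndF mF]] := sigma_finiteT (@lebesgue_measure R).
have /sigma_finiteP[G [UG ndG mG]] := sigma_finiteT mu.
pose g (s : n.+1.-tuple RR) : RR * n.-tuple RR := (thead s, [tuple of behead s]).
have gK : cancel tuple_cons g by case=> x s; congr pair; apply: val_inj.
have mg : measurable_fun setT g.
  apply/measurable_fun_pairP; split.
    exact: (measurable_tnth ord0).
  exact: measurable_behead.
exists (fun k => g @^-1` (F k `*` G k)).
  apply/seteqP; split => // s _.
  have : setT (g s).1 by []; rewrite UF => -[i _ Fi].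
  have : setT (g s).2 by []; rewrite UG => -[j _ Gj].
  exists (maxn i j) => //; split.
    by move: Fi; exact/subsetPset/ndF/leq_maxl.
  by move: Gj; exact/subsetPset/ndG/leq_maxr.
move=> k; have [mFk Fk] := mF k; have [mGk Gk] := mG k; split.
  by rewrite -[X in measurable X]setTI; apply: mg => //; exact: measurableX.
have E : tuple_cons @^-1` (g @^-1` (F k `*` G k)) = F k `*` G k.
  by apply/funext => p; rewrite /preimage /mkset gK.
rewrite /cons_measure /pushforward E product_measure1E//.
by rewrite lte_mul_pinfty// ge0_fin_numE.
Qed.

HB.instance Definition _ :=
  Measure_isSigmaFinite.Build _ _ _ cons_measure cons_measure_sigma_finite.

End cons_measure.

Fixpoint lebesgue_tuple (n : nat) :
    {sigma_finite_measure set (n.-tuple RR) -> \bar R} :=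
  if n is m.+1 then cons_measure (lebesgue_tuple m) else \d_([tuple] : 0.-tuple RR).

(* A fundamental domain of the torus R^d/(2 pi Z)^d, up to a null set; functions
   on the torus are functions of [k : d.-tuple R], 2 pi-periodic in each entry. *)
Definition torus_box {d : nat} : set (d.-tuple RR) :=
  [set k | forall j, 0 <= tnth k j <= 2 * pi].

Definition torus_integrable {d : nat} (f : d.-tuple R -> Cplx R) : Prop :=
  (lebesgue_tuple d).-integrable torus_box (fun k => (complex.Re (f k))%:E) /\
  (lebesgue_tuple d).-integrable torus_box (fun k => (complex.Im (f k))%:E).

Definition torus_integral {d : nat} (f : d.-tuple R -> Cplx R) : Cplx R :=
  (\int[lebesgue_tuple d]_(k in torus_box) complex.Re (f k)) +i*
  (\int[lebesgue_tuple d]_(k in torus_box) complex.Im (f k)).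

End lebesgue_tuple.

(* The lattice vector with integer coordinates [u] in the basis formed by the
   rows of [B]. *)
Definition lattice_vector {R : realType} {d : nat} (B : 'M[R]_d)
    (u : 'rV[int]_d) : 'rV[R]_d :=
  map_mx intr u *m B.

(* [p] is a chain of edges leading from [x] to [y]. *)
Fixpoint walk {T : Type} {E : Type} (src tgt : E -> T) (x y : T) (p : seq E)
    : Prop :=
  if p is e :: p' then src e = x /\ walk src tgt (tgt e) y p' else x = y.

(* Vertices are points of R^d. Oriented edges form an abstract set with
   endpoint maps (so loops and multiple edges are allowed), the reversal of
   orientation, and the action [shift u] of the translation by the lattice
   vector with coordinates [u]. *)
Record periodic_graph (R : realType) (d : nat) := PeriodicGraph {
  basis : 'M[R]_d;
  basis_unit : basis \in unitmx;
  vertex : set 'rV[R]_d;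
  edge : choiceType;
  src : edge -> 'rV[R]_d;
  tgt : edge -> 'rV[R]_d;
  rev : edge -> edge;
  shift : 'rV[int]_d -> edge -> edge;
  src_vertex : forall e, vertex (src e);
  tgt_vertex : forall e, vertex (tgt e);
  revK : involutive rev;
  rev_neq : forall e, rev e <> e;
  src_rev : forall e, src (rev e) = tgt e;
  vertex_shift : forall u x, vertex x -> vertex (x + lattice_vector basis u);
  shift0 : forall e, shift 0 e = e;
  shiftD : forall u v e, shift (u + v) e = shift u (shift v e);
  src_shift : forall u e, src (shift u e) = src e + lattice_vector basis u;
  tgt_shift : forall u e, tgt (shift u e) = tgt e + lattice_vector basis u;
  rev_shift : forall u e, rev (shift u e) = shift u (rev e);
  vertex_infinite : infinite_set vertex;
  connected : forall x y, vertex x -> vertex y -> exists p, walk src tgt x y p;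
  locally_finite : forall x, vertex x -> finite_set [set e | src e = x];
  vertex_cofinite :
    finite_set [set [set x + lattice_vector basis u | u in setT] | x in vertex];
  edge_cofinite :
    finite_set [set [set shift u e | u in setT] | e in [set: edge]]
}.

Section periodic_graph.
Context {R : realType} {d : nat} (G : periodic_graph R d).

Local Notation lat := (lattice_vector (basis G)).
Local Notation Vertex := 'rV[R]_d.
Local Notation Edge := (edge G).

Definition degree (x : Vertex) : nat := #|` fset_set [set e : Edge | src e = x]|.

Definition cell : set Vertex :=
  [set x | exists2 s : 'rV[R]_d, (forall j, 0 <= s 0 j < 1) & x = s *m basis G].

(* The integer coordinates of the lattice part of [x]. *)
Definition lattice_coord (x : Vertex) : 'rV[int]_d :=
  \row_j Num.floor ((x *m invmx (basis G)) 0 j).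

Lemma lattice_coordP (x : Vertex) (u : 'rV[int]_d) :
  cell (x - lat u) <-> u = lattice_coord x.
Proof.
have Bu := basis_unit G; split.
  move=> [s s01 xE]; apply/rowP => j; rewrite mxE.
  have -> : x = (s + map_mx intr u) *m basis G.
    by rewrite mulmxDl -xE subrK.
  rewrite mulmxK// !mxE; apply/esym/floor_def.
  by have /andP[s0 s1] := s01 j; rewrite lerDr s0 intrD addrC ltrD2l s1.
move=> ->; exists (x *m invmx (basis G) - map_mx intr (lattice_coord x)).
  rewrite /lattice_coord; move: (x *m _) => y j; rewrite !mxE subr_ge0 ltrBlDl.
  have /andP[-> lt_fl] := floor_itv (y 0 j).
  by move: lt_fl; rewrite intrD.
by rewrite mulmxBl mulmxKV.
Qed.

Definition edge_index (e : Edge) : 'rV[int]_d :=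
  lattice_coord (tgt e) - lattice_coord (src e).

Lemma lattice_coordD (x : Vertex) (u : 'rV[int]_d) :
  lattice_coord (x + lat u) = lattice_coord x + u.
Proof.
apply/esym/lattice_coordP.
rewrite /lattice_vector raddfD/= mulmxDl opprD addrACA subrr addr0.
exact/lattice_coordP.
Qed.

Lemma edge_index_shift u (e : Edge) : edge_index (shift u e) = edge_index e.
Proof.
by rewrite /edge_index src_shift tgt_shift !lattice_coordD opprD addrACA subrr addr0.
Qed.

Definition vertex_orbit (x : Vertex) : set Vertex := [set x + lat u | u in setT].
Definition edge_orbit (e : Edge) : set Edge := [set shift u e | u in setT].

Definition fvertex : finType :=
  fset_set [set vertex_orbit x | x in vertex G].
Definition fedge : finType := fset_set [set edge_orbit e | e in [set: Edge]].

Lemma fvertexP (X : fvertex) : exists2 x, vertex G x & vertex_orbit x = val X.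
Proof.
by have := valP X; rewrite in_fset_set ?inE//; exact: vertex_cofinite.
Qed.

Lemma fedgeP (E : fedge) : exists e, edge_orbit e = val E.
Proof.
have := valP E; rewrite in_fset_set ?inE; last exact: edge_cofinite.
by case=> e _ <-; exists e.
Qed.

Definition vrepr (X : fvertex) : Vertex := sval (cid2 (fvertexP X)).
Definition erepr (E : fedge) : Edge := sval (cid (fedgeP E)).

Fact vertex_orbit_in (x : Vertex) : vertex G x ->
  vertex_orbit x \in fset_set [set vertex_orbit x | x in vertex G].
Proof.
by move=> Vx; rewrite in_fset_set ?inE; [exists x|exact: vertex_cofinite].
Qed.

Fact edge_orbit_in (e : Edge) :
  edge_orbit e \in fset_set [set edge_orbit e | e in [set: Edge]].
Proof. by rewrite in_fset_set ?inE; [exists e|exact: edge_cofinite]. Qed.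

Definition vproj (x : Vertex) (Vx : vertex G x) : fvertex :=
  [` vertex_orbit_in Vx]%fset.
Definition eproj (e : Edge) : fedge := [` edge_orbit_in e]%fset.

(* Functions on the fundamental graph are defined through representatives; the
   lemmas below show that the choice does not matter. *)
Definition fsrc (E : fedge) : fvertex := vproj (src_vertex (erepr E)).
Definition ftgt (E : fedge) : fvertex := vproj (tgt_vertex (erepr E)).
Definition findex (E : fedge) : 'rV[int]_d := edge_index (erepr E).
Definition fdegree (X : fvertex) : nat := degree (vrepr X).
Definition fpotential (pot : Vertex -> R) (X : fvertex) : R := pot (vrepr X).

(* Only the values of [pot] on vertices matter. *)
Definition periodic_potential (pot : Vertex -> R) : Prop :=
  forall x u, vertex G x -> pot (x + lat u) = pot x.

Lemma erepr_eproj (e : Edge) : exists u, erepr (eproj e) = shift u e.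
Proof.
rewrite /erepr; case: cid => e' /= e'E.
have : edge_orbit e' e' by exists 0 => //; exact: shift0.
by rewrite e'E => -[u _ <-]; exists u.
Qed.

Lemma vrepr_vproj (x : Vertex) (Vx : vertex G x) :
  exists u, vrepr (vproj Vx) = x + lat u.
Proof.
rewrite /vrepr; case: cid2 => y /= _ yE.
have : vertex_orbit y y by exists 0; rewrite // /lattice_vector raddf0 mul0mx addr0.
by rewrite yE => -[u _ <-]; exists u.
Qed.

Lemma vproj_shift (x y : Vertex) (Vx : vertex G x) (Vy : vertex G y) u :
  y = x + lat u -> vproj Vy = vproj Vx.
Proof.
move=> yE; apply: val_inj; apply/seteqP; split => z /= [v _ <-].
  by exists (u + v) => //; rewrite yE /lattice_vector raddfD/= mulmxDl addrA.
exists (v - u) => //.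
by rewrite yE /lattice_vector raddfB/= mulmxBl -addrA [_ + (_ - _)]addrC subrK.
Qed.

Lemma fsrc_eproj (e : Edge) : fsrc (eproj e) = vproj (src_vertex e).
Proof.
have [u eE] := erepr_eproj e.
by apply: (@vproj_shift _ _ _ _ u); rewrite eE src_shift.
Qed.

Lemma ftgt_eproj (e : Edge) : ftgt (eproj e) = vproj (tgt_vertex e).
Proof.
have [u eE] := erepr_eproj e.
by apply: (@vproj_shift _ _ _ _ u); rewrite eE tgt_shift.
Qed.

Lemma findex_eproj (e : Edge) : findex (eproj e) = edge_index e.
Proof.
by have [u eE] := erepr_eproj e; rewrite /findex eE edge_index_shift.
Qed.

Lemma fdegree_vproj (x : Vertex) (Vx : vertex G x) :
  fdegree (vproj Vx) = degree x.
Proof.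
have [u E] := vrepr_vproj Vx; rewrite /fdegree E /degree.
have shiftK v : cancel (@shift _ _ G v) (shift (- v)).
  by move=> e; rewrite -shiftD addNr shift0.
have -> : [set e : Edge | src e = x + lat u] =
    shift u @` [set e : Edge | src e = x].
  apply/seteqP; split => [e /= eE|_ [e /= eE <-]]; last by rewrite src_shift eE.
  exists (shift (- u) e); last by rewrite -shiftD subrr shift0.
  by rewrite /= src_shift eE /lattice_vector raddfN/= mulNmx addrK.
rewrite fset_set_image; last exact: locally_finite.
by rewrite card_imfset//; exact: can_inj (shiftK u).
Qed.

Lemma fpotential_vproj pot (x : Vertex) (Vx : vertex G x) :
  periodic_potential pot -> fpotential pot (vproj Vx) = pot x.
Proof. by move=> potP; have [u E] := vrepr_vproj Vx; rewrite /fpotential E potP. Qed.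

Definition pairing (m : 'rV[int]_d) (k : d.-tuple R) : R :=
  \sum_j (m 0 j)%:~R * tnth k j.

Local Notation nu := #|{: fvertex}|.

Definition fiber_adjacency (k : d.-tuple R) : 'M[Cplx R]_nu :=
  \matrix_(i, j) \sum_(E : fedge | (fsrc E == enum_val i) && (ftgt E == enum_val j))
    expi (pairing (findex E) k).

Definition vertex_diag (f : fvertex -> R) : 'M[Cplx R]_nu :=
  diag_mx (\row_i ((f (enum_val i))%:C : Cplx R)).

Definition fiber_schrodinger (pot : Vertex -> R) (k : d.-tuple R) :
    'M[Cplx R]_nu :=
  fiber_adjacency k - vertex_diag (fun X => (fdegree X)%:R)
  + vertex_diag (fpotential pot).

(* [inl E] is an edge of the fundamental graph, [inr X] the loop added at [X]. *)
Definition medge : finType := (fedge + fvertex)%type.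

Definition msrc (e : medge) : fvertex :=
  match e with inl E => fsrc E | inr X => X end.
Definition mtgt (e : medge) : fvertex :=
  match e with inl E => ftgt E | inr X => X end.
Definition mindex (e : medge) : 'rV[int]_d :=
  match e with inl E => findex E | inr _ => 0 end.
Definition mweight (pot : Vertex -> R) (e : medge) : R :=
  match e with inl _ => 1 | inr X => fpotential pot X - (fdegree X)%:R end.

Definition cycle_index (c : seq medge) : 'rV[int]_d := \sum_(e <- c) mindex e.
Definition cycle_weight (pot : Vertex -> R) (c : seq medge) : R :=
  \prod_(e <- c) mweight pot e.

Definition cycles : set (seq medge) :=
  [set c | (0 < size c)%N /\ path.cycle (fun e f => mtgt e == msrc f) c].
Definition cycles_of_size (n : nat) : set (seq medge) :=
  cycles `&` [set c | size c = n].
Definition cycles_of_index (m : 'rV[int]_d) : set (seq medge) :=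
  cycles `&` [set c | cycle_index c = m].

Definition cycle_sum (pot : Vertex -> R) (n : nat) (k : d.-tuple R) : R :=
  \sum_(c \in cycles_of_size n)
    cycle_weight pot c * cos (pairing (cycle_index c) k).

Definition cycle_sum0 (pot : Vertex -> R) (n : nat) : R :=
  \sum_(c \in cycles_of_size n `&` cycles_of_index 0) cycle_weight pot c.

Definition cycle_term (pot : Vertex -> R) (t : Cplx R) (c : seq medge) : Cplx R :=
  (cycle_weight pot c / (size c)`!%:R)%:C * t ^+ size c.

Definition heat_coef (pot : Vertex -> R) (t : Cplx R) (m : 'rV[int]_d) : Cplx R :=
  sum_over (cycles_of_index m) (cycle_term pot t).

Definition heat_trace (pot : Vertex -> R) (t : Cplx R) (k : d.-tuple R) : Cplx R :=
  \tr (mexp (t *: fiber_schrodinger pot k)).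

End periodic_graph.

Arguments cycles {R d} G.
Arguments cycles_of_size {R d} G n.
Arguments cycles_of_index {R d} G m.

(* Main.v *)
(* The powers of H(k) expand over walks: H(k) is the weighted adjacency matrix
   of the modified graph, so Tr H(k)^n is the sum over the closed walks c of
   length n of omega(c) exp(i <tau(c), k>). Reversing edges shows that H(k) is
   Hermitian; the trace is therefore real and only the cosine survives.

   With W the sum of |omega(e)| over all edges, the terms of all the series are
   dominated by the expansion of exp(W |t|), so the sum over all cycles is
   absolutely convergent. The series over n and over m are obtained from it by
   grouping the cycles according to their length, respectively their index.

   The constant Fourier coefficient follows by dominated convergence. The
   integral of cos(a + <m, k>) over the torus is (2 pi)^d cos a if m = 0 and 0
   otherwise; carrying the phase a makes this an induction on d through Fubini,
   without products of trigonometric functions. *)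

Require Import Defs.
Set Warnings "-all".
From HB Require Import structures.
From mathcomp Require Import all_boot all_order all_algebra finmap.
From mathcomp Require Import complex.
From mathcomp Require Import all_classical all_reals all_analysis.
From mathcomp Require Import measurable_realfun.
From mathcomp.analysis.showcase Require summability.

Set Implicit Arguments.
Unset Strict Implicit.
Unset Printing Implicit Defensive.

Import Order.TTheory GRing.Theory Num.Theory numFieldNormedType.Exports.

Local Open Scope classical_set_scope.
Local Open Scope ring_scope.
Local Open Scope complex_scope.

(** * Unordered summation of complex families *)

Section HasSum.
Context {R : realType}.
Local Notation C := (Cplx R).
Local Notation nm := (@Normc.normc R).
Implicit Types (I J : choiceType) (s : C).

Lemma normc_ge0 (x : C) : 0 <= nm x.
Proof. by case: x => a b; exact: sqrtr_ge0. Qed.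

Lemma norm_normcE (x : C) : `|x| = (nm x)%:C.
Proof. by []. Qed.

Lemma normc_real (x : R) : nm x%:C = `|x|.
Proof. by rewrite /= expr0n addr0 sqrtr_sqr. Qed.

Lemma normcX (x : C) n : nm (x ^+ n) = nm x ^+ n.
Proof.
by elim: n => [|n IH]; rewrite ?expr0 ?Normc.normc1 // !exprS Normc.normcM IH.
Qed.

Lemma normc_nat n : nm n%:R = n%:R.
Proof. by rewrite -(rmorph_nat (real_complex R)) normc_real normr_nat. Qed.

Lemma normc_Re (x : C) : `|complex.Re x| <= nm x.
Proof. by have := normc_ge_Re x; rewrite lecR. Qed.

Lemma normc_Im (x : C) : `|complex.Im x| <= nm x.
Proof.
case: x => a b /=; rewrite -sqrtr_sqr ler_wsqrtr // lerDr; exact: sqr_ge0.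
Qed.

Lemma normc_sum I (r : seq I) (P : pred I) (f : I -> C) :
  nm (\sum_(i <- r | P i) f i) <= \sum_(i <- r | P i) nm (f i).
Proof.
elim/big_rec2: _ => [|i y x _ le]; first by rewrite Normc.normc0.
by apply: le_trans (le_normcD _ _) _; rewrite lerD2l.
Qed.

(** Convergence along the finite subsets of a whole type. A sum over a subset [D] is expressed by
    [patch (fun=> 0) D f], so one notion serves cycles, lengths and indices alike. *)
Definition has_sum I (f : I -> C) (s : C) := forall e : R, 0 < e ->
  exists A : {fset I}, forall B : {fset I}, (A `<=` B)%fset ->
    nm (s - \sum_(i <- B) f i) < e.

(** Absolute summability with an explicit constant: keeping [M] visible lets the same bound pass
    from one series to another and later dominate an integrand. *)
Definition sums_bounded I (f : I -> C) (M : R) :=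
  forall B : {fset I}, \sum_(i <- B) nm (f i) <= M.

Lemma eq_has_sum I (f g : I -> C) s : f =1 g -> has_sum f s -> has_sum g s.
Proof. by move=> /funext ->. Qed.

Lemma has_sumD I (f g : I -> C) s t :
  has_sum f s -> has_sum g t -> has_sum (fun i => f i + g i) (s + t).
Proof.
move=> fs gt e e0; have e2 : 0 < e / 2 by rewrite divr_gt0.
have [A hA] := fs _ e2; have [B hB] := gt _ e2.
exists (A `|` B)%fset => D; rewrite fsubUset => /andP[AD BD].
rewrite big_split /= opprD addrACA (splitr e).
exact: le_lt_trans (le_normcD _ _) (ltrD (hA _ AD) (hB _ BD)).
Qed.

Lemma has_sumZ I (f : I -> C) s (z : C) :
  has_sum f s -> has_sum (fun i => z * f i) (z * s).
Proof.
move=> fs e e0; have z0 : 0 < nm z + 1 by rewrite ltr_wpDl // normc_ge0.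
have [A hA] := fs (e / (nm z + 1)) (divr_gt0 e0 z0).
exists A => B /hA; rewrite ltr_pdivlMr // -mulr_sumr -mulrBr Normc.normcM.
by apply: le_lt_trans; rewrite mulrC ler_wpM2l ?normc_ge0 // lerDl.
Qed.

Lemma has_sum_unique I (f : I -> C) s t : has_sum f s -> has_sum f t -> s = t.
Proof.
move=> fs ft; apply/eqP; rewrite -subr_eq0; apply/eqP/Normc.eq0_normc/eqP.
rewrite eq_le normc_ge0 andbT; apply/ler_addgt0Pl => e e0; rewrite addr0.
have e2 : 0 < e / 2 by rewrite divr_gt0.
have [A hA] := fs _ e2; have [B hB] := ft _ e2.
have := ltrD (hA _ (fsubsetUl A B)) (hB _ (fsubsetUr A B)).
rewrite -splitr => lt; apply/ltW/(le_lt_trans _ lt).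
rewrite -(normcN (t - _)); apply: le_trans (le_normcD _ _).
by rewrite opprB addrA subrK.
Qed.

Lemma has_sum_fset I (f : I -> C) (A : {fset I}) :
  (forall i, i \notin A -> f i = 0) -> has_sum f (\sum_(i <- A) f i).
Proof.
move=> fA e e0; exists A => B AB.
by rewrite -(big_fset_incl _ AB) ?subrr ?Normc.normc0 // => i _ /fA.
Qed.

(** The sum is the supremum of the finite partial sums; since the terms are nonnegative, a set that
    nearly attains it can only come closer when enlarged. *)
Lemma has_sum_ge0 I (g : I -> R) M : (forall i, 0 <= g i) ->
  (forall B : {fset I}, \sum_(i <- B) g i <= M) ->
  exists s, has_sum (fun i => (g i)%:C : C) s.
Proof.
move=> g0 gM; pose S := [set \sum_(i <- B) g i | B in [set: {fset I}]].
have supS : has_sup S.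
  by split; [exists (\sum_(i <- fset0) g i), fset0|exists M => _ [B _ <-]].
exists (sup S)%:C => e e0; have [_ [A _ <-] ltA] := sup_adherent e0 supS.
exists A => B AB; rewrite -rmorph_sum -rmorphB normc_real.
rewrite ger0_norm ?subr_ge0; last by apply: sup_upper_bound => //; exists B.
rewrite ltrBlDr -ltrBlDl; apply: lt_le_trans ltA _.
(* Truncating [g] to [A] turns the sum over [A] into one over [B], which can be compared term by
   term. *)
rewrite (_ : \sum_(i <- A) g i = \sum_(i <- A) if i \in A then g i else 0).
  rewrite (big_fset_incl _ AB); first by apply: ler_sum => i _; case: ifP.
  by move=> i _ /negPf ->.
by rewrite big_seq [RHS]big_seq; apply: eq_bigr => i ->.
Qed.

(** Write [f] as [(f + |f|) - |f|], a difference of nonnegative families with partial sums at most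
    [M + M] and [M]. *)
Lemma has_sum_real I (f : I -> R) M :
  (forall B : {fset I}, \sum_(i <- B) `|f i| <= M) ->
  exists s, has_sum (fun i => (f i)%:C : C) s.
Proof.
move=> fM; have [//|s hs] := has_sum_ge0 (g := fun i => `|f i|) _ fM.
have [||t ht] := @has_sum_ge0 _ (fun i => f i + `|f i|) (M + M).
- by move=> i; rewrite -lerBlDl sub0r -normrN ler_norm.
- move=> B; rewrite big_split lerD // (le_trans _ (fM B)) //.
  by apply: ler_sum => i _; exact: ler_norm.
exists (t + (-1) * s); apply: eq_has_sum (has_sumD ht (has_sumZ (-1) hs)) => i.
by rewrite mulN1r -rmorphB addrK.
Qed.

(** The real and imaginary parts are dominated by the modulus, so each of them has a sum. *)
Lemma has_sum_exists I (f : I -> C) M :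
  sums_bounded f M -> exists s, has_sum f s.
Proof.
move=> fM.
have [|s hs] := @has_sum_real _ (fun i => complex.Re (f i)) M.
  by move=> B; apply: le_trans (fM B); apply: ler_sum => i _; exact: normc_Re.
have [|t ht] := @has_sum_real _ (fun i => complex.Im (f i)) M.
  by move=> B; apply: le_trans (fM B); apply: ler_sum => i _; exact: normc_Im.
exists (s + 'i * t); apply: eq_has_sum (has_sumD hs (has_sumZ 'i ht)) => i.
by rewrite -complexE.
Qed.

Lemma le_sums_bounded I (f g : I -> C) M :
  (forall i, nm (g i) <= nm (f i)) -> sums_bounded f M -> sums_bounded g M.
Proof. by move=> gf fM B; apply: le_trans (fM B); exact: ler_sum. Qed.

Lemma has_sum_sum I J (r : seq J) (f : J -> I -> C) (s : J -> C) :
  (forall j, has_sum (f j) (s j)) ->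
  has_sum (fun i => \sum_(j <- r) f j i) (\sum_(j <- r) s j).
Proof.
move=> fs; elim: r => [|j r IH].
  have := @has_sum_fset I (fun=> 0) fset0 (fun _ _ => erefl).
  by rewrite !big_nil; apply: eq_has_sum => i; rewrite big_nil.
rewrite big_cons; apply: eq_has_sum (has_sumD (fs j) IH) => i.
by rewrite big_cons.
Qed.

(** * Regrouping a sum along the fibres of a map *)

Section fibres.
Context {I J : choiceType} (phi : I -> J) (f : I -> C) (g : J -> C).
Hypothesis fg : forall j,
  has_sum (fun i => if phi i == j then f i else 0) (g j).

(** One finite set [D] above [B] approximates all fibre sums at once: it collects [A] and a good
    approximating set for each [j] in [B], restricted to the indices that [phi] sends into [B]. *)
Lemma fibre_approx (A : {fset I}) (B : {fset J}) (e : R) : 0 < e ->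
  (forall i, i \in A -> phi i \in B) ->
  exists D : {fset I}, (A `<=` D)%fset /\
    exists2 h : J -> C, forall j, h j = \sum_(i <- D) if phi i == j then f i else 0
    & (forall i, i \in D -> phi i \in B) /\ \sum_(j <- B) nm (g j - h j) < e.
Proof.
(* Each fibre gets the error [e / (size B).+1]; the successor covers an empty [B] and makes the
   total strictly less than [e]. *)
move=> e0 AB; have N0 : 0 < (size B).+1%:R :> R by rewrite ltr0n.
have [a ha] := choice (fun j => fg j (divr_gt0 e0 N0)).
pose D := [fset i in (A `|` \bigcup_(j <- B) a j)%fset | phi i \in B]%fset.
exists D; split; first by apply/fsubsetP => i iA; rewrite !inE /= iA AB.
exists (fun j => \sum_(i <- D) if phi i == j then f i else 0) => //; split.
  by move=> i; rewrite !inE /= => /andP[].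
apply: (@le_lt_trans _ _ (\sum_(j <- B) (e / (size B).+1%:R))).
  rewrite big_seq [leRHS]big_seq; apply: ler_sum => j jB; apply/ltW.
  (* The indices discarded from the union lie outside the fibre of [j], so they contribute 0. *)
  rewrite (_ : \sum_(i <- D) _ = \sum_(i <- (A `|` \bigcup_(j <- B) a j)%fset)
      if phi i == j then f i else 0).
    by apply: ha; rewrite fsubsetU // (bigfcup_sup _ jB) ?orbT.
  apply: big_fset_incl; first by apply/fsubsetP => i; rewrite !inE /= => /andP[].
  move=> i iU; rewrite !inE /= negb_and; case: eqP => // -> /orP[|/negP//].
  by rewrite !inE in iU; rewrite iU.
rewrite big_const_seq count_predT iter_addr_0 -[_ *+ _]mulr_natr mulrAC -mulrA.
by rewrite gtr_pMr // ltr_pdivrMr // mul1r ltr_nat.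
Qed.

Lemma sum_fibres (K : nmodType) (F : I -> K) (D : {fset I}) (B : {fset J}) :
  (forall i, i \in D -> phi i \in B) ->
  \sum_(j <- B) \sum_(i <- D) (if phi i == j then F i else 0) = \sum_(i <- D) F i.
Proof.
move=> DB; rewrite exchange_big big_seq [RHS]big_seq; apply: eq_bigr => i /DB iB.
rewrite (big_fsetD1 _ iB) /= eqxx big_seq big1 ?addr0 // => j.
by rewrite !inE eq_sym => /andP[/negPf ->].
Qed.

(** As soon as [B] contains the image of [A], the sum of [f] over [D] is within [e / 2] both of [s]
    and of the sum of [g] over [B]. *)
Lemma has_sum_fibres s : has_sum f s -> has_sum g s.
Proof.
move=> fs e e0; have e2 : 0 < e / 2 by rewrite divr_gt0.
have [A hA] := fs _ e2; exists (phi @` A)%fset => B AB.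
have [i iA|D [AD [h hE [DB hlt]]]] := @fibre_approx A B _ e2.
  by apply: (fsubsetP AB); exact: in_imfset.
rewrite -(subrKA (\sum_(i <- D) f i)) (splitr e).
apply: le_lt_trans (le_normcD _ _) (ltrD (hA _ AD) _).
rewrite -(sum_fibres _ DB) (eq_bigr h) => [|j _]; last by rewrite hE.
rewrite -normcN opprB -sumrB; exact: le_lt_trans (normc_sum _ _ _) hlt.
Qed.

(** Regrouping keeps the constant: up to an arbitrary [e], the moduli of the fibre sums are those of
    finite sums over disjoint parts of [D]. *)
Lemma sums_bounded_fibres M : sums_bounded f M -> sums_bounded g M.
Proof.
move=> fM B; apply/ler_addgt0Pl => e e0.
have [//|D [_ [h hE [DB hlt]]]] := @fibre_approx fset0 B _ e0.
apply: (@le_trans _ _ (\sum_(j <- B) (nm (g j - h j) + nm (h j)))).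
  by apply: ler_sum => j _; rewrite -{1}(subrK (h j) (g j)); exact: le_normcD.
rewrite big_split lerD ?(ltW hlt) //; apply: le_trans (fM D).
rewrite -(sum_fibres (fun i => nm (f i)) DB); apply: ler_sum => j _.
rewrite hE; apply: le_trans (normc_sum _ _ _) _; apply: ler_sum => i _.
by case: ifP => // _; rewrite Normc.normc0.
Qed.

End fibres.

(** A bound for finite sums over the whole type also holds inside [D], hence bounds the supremum
    that defines summability. *)
Lemma abs_summable_bounded I (D : set I) (f : I -> C) M :
  sums_bounded f M -> abs_summable D f.
Proof.
move=> fM; apply: (@le_lt_trans _ _ M%:E); last exact: ltry.
apply: ge_ereal_sup => _ [X [finX _] <-].
rewrite fsbig_finite //= sumEFin lee_fin.
apply: le_trans (fM (fset_set X)); apply: ler_sum => i _.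
by rewrite ger0_norm // normc_ge0.
Qed.

Lemma sums_bounded_patch I (D : set I) (f : I -> C) M :
  sums_bounded f M -> sums_bounded (patch (fun=> 0) D f) M.
Proof.
apply: le_sums_bounded => i; rewrite /patch; case: ifP => // _.
by rewrite Normc.normc0 normc_ge0.
Qed.

(** Identifies the epsilon formulation with the limit along the filter of finite sets. *)
Lemma sum_over_has_sum I (D : set I) (f : I -> C) s :
  has_sum (patch (fun=> 0) D f) s -> sum_over D f = s.
Proof.
move=> hs; have PF := @summability.totally_filter I.
apply: cvg_lim; first exact: norm_hausdorff.
(* A positive element of [R[i]] is real, so the tolerance can be taken in [R]. *)
apply/cvgrPdist_lt => e e0; have eR : (complex.Re e)%:C = e.
  by rewrite RRe_real // gtr0_real.
have [|A hA] := hs (complex.Re e); first by rewrite -ltcR eR.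
exists A => // B /= /hA lt.
by rewrite /summability.partial_sum -(big_seq_fsetE _ B xpredT) norm_normcE -eR ltcR.
Qed.

Lemma has_sum_nat (f : nat -> C) s :
  has_sum f s -> (fun N => \sum_(0 <= n < N) f n) @ \oo --> s.
Proof.
move=> hs; apply/cvgrPdist_lt => e e0; have eR : (complex.Re e)%:C = e.
  by rewrite RRe_real // gtr0_real.
have [|A hA] := hs (complex.Re e); first by rewrite -ltcR eR.
(* From this rank on, the initial segment contains [A]. *)
exists (\max_(i <- A) i).+1 => // N /= AN.
have -> : \sum_(0 <= n < N) f n = \sum_(n <- [fset n in index_iota 0 N]%fset) f n.
  apply: perm_big; apply: uniq_perm; [exact: iota_uniq|exact: fset_uniq|].
  by move=> n; rewrite !inE.
rewrite norm_normcE -eR ltcR; apply: hA; apply/fsubsetP => n nA.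
rewrite !inE /= mem_index_iota; apply: leq_trans AN; rewrite ltnS.
exact: (@leq_bigmax_seq _ _ _ id).
Qed.

Lemma cvg_sums_from1 (f : nat -> C) s : f 0 = 0 -> has_sum f s ->
  (fun N => \sum_(1 <= n < N) f n) @ \oo --> s.
Proof.
move=> f0 fs.
have -> : (fun N => \sum_(1 <= n < N) f n) = (fun N => \sum_(0 <= n < N) f n).
  apply/funext => -[|N]; first by rewrite !big_geq.
  by rewrite [RHS]big_ltn // f0 add0r.
exact: has_sum_nat.
Qed.

Lemma limn_sums_from1 (f : nat -> C) s : f 0 = 0 -> has_sum f s ->
  limn (fun N => \sum_(1 <= n < N) f n) = s.
Proof.
move=> f0 fs; apply: cvg_lim; [exact: norm_hausdorff|exact: cvg_sums_from1].
Qed.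

Lemma sums_bounded_nat (f : nat -> C) M :
  (forall N, \sum_(0 <= n < N) nm (f n) <= M) -> sums_bounded f M.
Proof.
move=> fM B; set N := (\max_(i <- B) i).+1; apply: le_trans (fM N).
have BN : {subset B <= index_iota 0 N}.
  by move=> n nB; rewrite mem_index_iota ltnS; exact: (@leq_bigmax_seq _ _ _ id).
rewrite [leRHS](bigID (mem B)) /= -[leLHS]addr0 lerD //; last first.
  by apply: sumr_ge0 => n _; exact: normc_ge0.
rewrite -[leRHS]big_filter le_eqVlt; apply/orP; left; apply/eqP.
apply: perm_big; apply: uniq_perm; [exact: fset_uniq|exact/filter_uniq/iota_uniq|].
by move=> n; rewrite mem_filter andb_idr // => /BN.
Qed.

End HasSum.

(** * The trace of the matrix exponential as a scalar series *)

Section MatrixExponential.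
Context {R : realType}.
Local Notation C := (Cplx R).
Local Notation nm := (@Normc.normc R).

Lemma exp_partial_sum_le (x : R) N : 0 <= x ->
  \sum_(0 <= n < N) x ^+ n / n`!%:R <= expR x.
Proof.
move=> x0; apply: (@nondecreasing_cvgn_le _ (series (exp_coeff x))) => [|//].
  apply: nondecreasing_series => n _ _; exact: exp_coeff_ge0.
exact: is_cvg_series_exp_coeff.
Qed.

(** The total of the moduli of the entries dominates every row sum, so each further factor [A] costs
    at most this total. *)
Lemma entry_expr_le n (A : 'M[C]_n) m i j :
  nm ((A ^+ m) i j) <= (\sum_k \sum_l nm (A k l)) ^+ m.
Proof.
elim: m i j => [|m IH] i j.
  by rewrite expr0 mxE; case: eqP => _; rewrite ?Normc.normc1 ?Normc.normc0.
rewrite exprS -mulmxE mxE exprS.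
apply: le_trans (normc_sum _ _ _) _.
apply: (@le_trans _ _ (\sum_l nm (A i l) * (\sum_k \sum_l nm (A k l)) ^+ m)).
  by apply: ler_sum => l _; rewrite Normc.normcM ler_wpM2l // normc_ge0.
rewrite -mulr_suml ler_wpM2r //.
  by apply/exprn_ge0/sumr_ge0 => k _; apply: sumr_ge0 => l _; exact: normc_ge0.
rewrite [leRHS](bigD1 i) //= lerDl.
by apply: sumr_ge0 => k _; apply: sumr_ge0 => l _; exact: normc_ge0.
Qed.

(** A neighbourhood of a matrix contains a product of neighbourhoods of its entries, and there are
    finitely many entries. *)
Lemma cvg_mx m n (u : nat -> 'M[C]_(m, n)) (L : 'M[C]_(m, n)) :
  (forall i j, (fun N => u N i j) @ \oo --> L i j) -> u @ \oo --> L.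
Proof.
move=> uL A [P LP sPA].
have : \forall N \near \oo, forall i j, P i j (u N i j).
  apply: filter_forall => i; apply: filter_forall => j.
  exact: uL (LP i j).
by apply: filterS => N PN; exact: sPA.
Qed.

(** Each entry series is dominated by the expansion of [expR K]; the matrix [L] of the entry sums is
    therefore the limit defining [mexp A], and the trace is a finite sum of entry series. *)
Lemma has_sum_tr_mexp n (A : 'M[C]_n) :
  has_sum (fun m => m`!%:R^-1 * \tr (A ^+ m)) (\tr (mexp A)).
Proof.
set K := \sum_k \sum_l nm (A k l).
have entry i j : exists s, has_sum (fun m => m`!%:R^-1 * (A ^+ m) i j : C) s.
  apply: (@has_sum_exists _ _ _ (expR K)); apply: sums_bounded_nat => N.
  have K0 : 0 <= K.
    by apply: sumr_ge0 => k _; apply: sumr_ge0 => l _; exact: normc_ge0.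
  apply: le_trans (exp_partial_sum_le N K0); apply: ler_sum => m _.
  rewrite Normc.normcM Normc.normcV normc_nat mulrC ler_wpM2r //.
  exact: entry_expr_le.
pose L : 'M[C]_n := \matrix_(i, j) sval (cid (entry i j)).
have hL i j : has_sum (fun m => m`!%:R^-1 * (A ^+ m) i j : C) (L i j).
  by rewrite mxE; case: cid.
have -> : mexp A = L.
  apply: cvg_lim; first exact: norm_hausdorff.
  apply: cvg_mx => i j.
  have -> : (fun N => series (fun j : nat => (j`!%:R)^-1 *: A ^+ j) N i j) =
      (fun N => \sum_(0 <= m < N) m`!%:R^-1 * (A ^+ m) i j).
    by apply/funext => N; rewrite summxE; apply: eq_bigr => m _; rewrite mxE.
  exact: has_sum_nat.
have -> : (fun m => m`!%:R^-1 * \tr (A ^+ m)) =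
    (fun m => \sum_i (m`!%:R^-1 * (A ^+ m) i i)).
  by apply/funext => m; rewrite mulr_sumr.
exact: (has_sum_sum _ (fun i => hL i i)).
Qed.

End MatrixExponential.

(** * Powers of the weighted adjacency matrix of a finite multigraph *)

Section Walks.
Context {K : comNzRingType} {V E : finType} (s t : E -> V) (h : E -> K).

(** A decidable form of [walk], usable as the range of a finite sum. *)
Fixpoint bwalk (x y : V) (p : seq E) : bool :=
  if p is e :: q then (s e == x) && bwalk (t e) y q else x == y.

Lemma big_tuple_cons n (P : pred (seq E)) (F : seq E -> K) :
  \sum_(u : n.+1.-tuple E | P u) F u =
  \sum_e \sum_(u : n.-tuple E | P (e :: u)) F (e :: u).
Proof.
rewrite pair_big_dep /=.
rewrite (reindex (fun p : E * n.-tuple E => [tuple of p.1 :: p.2])) //=.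
exists (fun u => (thead u, [tuple of behead u])) => [[e u] _|u _].
  by congr pair; apply: val_inj.
by rewrite [in RHS](tuple_eta u).
Qed.

Lemma sum_tuple_prod n :
  \sum_(u : n.-tuple E) \prod_(e <- u) h e = (\sum_e h e) ^+ n.
Proof.
elim: n => [|n IH].
  rewrite expr0 (big_pred1 [tuple]) ?big_nil // => u.
  exact/esym/eqP/tuple0.
rewrite (big_tuple_cons n xpredT (fun u => \prod_(e <- u) h e)) exprS mulr_suml.
by apply: eq_bigr => e _; rewrite -IH mulr_sumr; apply: eq_bigr => u _; rewrite big_cons.
Qed.

Definition walk_mx : 'M[K]_#|V| :=
  \matrix_(i, j) \sum_(e | (s e == enum_val i) && (t e == enum_val j)) h e.

Lemma walk_mxX n i j : (walk_mx ^+ n) i j =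
  \sum_(u : n.-tuple E | bwalk (enum_val i) (enum_val j) u) \prod_(e <- u) h e.
Proof.
elim: n i j => [|n IH] i j.
  rewrite expr0 mxE; under eq_bigl do rewrite [X in bwalk _ _ (val X)]tuple0 /=.
  rewrite (inj_eq enum_val_inj); case: eqP => _; last by rewrite big_pred0.
  by rewrite (big_pred1 [tuple]) ?big_nil // => u; exact/esym/eqP/tuple0.
rewrite exprS -mulmxE mxE.
rewrite (big_tuple_cons n (bwalk (enum_val i) (enum_val j))
  (fun u => \prod_(e <- u) h e)).
rewrite (eq_bigr (fun k => \sum_e if (s e == enum_val i) && (t e == enum_val k)
   then h e * (walk_mx ^+ n) k j else 0)); last first.
  by move=> k _; rewrite mxE mulr_suml big_mkcond.
rewrite exchange_big; apply: eq_bigr => e _ /=.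
(* Once the first edge [e] is fixed, the intermediate vertex can only be its target. *)
rewrite (bigD1 (enum_rank (t e))) //= enum_rankK eqxx andbT big1 ?addr0; last first.
  move=> k; case: (t e =P _) => [->|_ _]; last by rewrite andbF.
  by rewrite enum_valK eqxx.
case: ifP => _ /=; last by rewrite big_pred0.
rewrite IH enum_rankK mulr_sumr.
by apply: eq_bigr => u _; rewrite big_cons.
Qed.

Lemma bwalk_path x y e q : bwalk x y (e :: q) =
  [&& s e == x, path.path (fun e f => t e == s f) e q & t (last e q) == y].
Proof.
rewrite /=; congr andb; elim: q e => [|f q IH] e //=.
by rewrite IH andbA [s f == _]eq_sym.
Qed.

(** A closed walk is counted once, in the diagonal entry of its starting vertex. The exponent is a
    successor because the empty sequence is a single [path.cycle], while the trace of the identity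
    counts all vertices. *)
Lemma tr_walk_mxX n : \tr (walk_mx ^+ n.+1) =
  \sum_(u : n.+1.-tuple E | path.cycle (fun e f => t e == s f) u)
    \prod_(e <- u) h e.
Proof.
rewrite /mxtrace; under eq_bigr do rewrite walk_mxX big_mkcond.
rewrite exchange_big [RHS]big_mkcond; apply: eq_bigr => u _ /=.
case/tupleP: u => e u; rewrite -big_mkcond /=.
case: ifP => [cyc|cyc].
  rewrite (big_pred1 (enum_rank (s e))) // => i.
  move: cyc; rewrite -/(bwalk _ _ (e :: u)) bwalk_path rcons_path => /andP[-> /eqP ->].
  by rewrite andTb andbb /= -(inj_eq enum_val_inj) enum_rankK eq_sym.
apply: big_pred0 => i; apply/negbTE; apply: contraFN cyc.
rewrite -/(bwalk _ _ (e :: u)) bwalk_path rcons_path.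
by move=> /and3P[/eqP -> -> ->].
Qed.

End Walks.

(** * Phases, traces of Hermitian powers, and sums over sequences of fixed length *)

Section Trace.
Context {R : realType}.
Local Notation C := (Cplx R).
Local Notation nm := (@Normc.normc R).

Lemma expi0 : expi 0 = 1 :> C.
Proof. by rewrite /expi cos0 sin0. Qed.

Lemma expiD (x y : R) : expi (x + y) = expi x * expi y.
Proof. by rewrite /expi cosD sinD [sin x * cos y + _]addrC. Qed.

Lemma conjc_expi (x : R) : conjc (expi x : R[i]) = expi (- x).
Proof. by rewrite /expi /= cosN sinN. Qed.

(** The hypothesis says that [A] is Hermitian: conjugating a power of it amounts to transposing,
    which leaves the trace unchanged. *)
Lemma conj_tr_expr n (A : 'M[C]_n) m : A^T = map_mx (conjc : C -> C) A ->
  conjc (\tr (A ^+ m) : R[i]) = \tr (A ^+ m).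
Proof.
move=> AT; have Am : map_mx (conjc : C -> C) (A ^+ m) = (A ^+ m)^T.
  elim: m => [|m IH]; first by rewrite !expr0 map_mx1 trmx1.
  by rewrite [in LHS]exprS exprSr -!mulmxE map_mxM IH -AT trmx_mul.
by rewrite -[RHS]mxtrace_tr -Am trace_map_mx.
Qed.

Lemma finite_size (E : finType) n : finite_set [set c : seq E | size c = n].
Proof.
apply: (@sub_finite_set _ _ (range (@tval n E))); last exact: finite_image.
by move=> c cn; exists (tcast cn (in_tuple c)) => //; rewrite val_tcast.
Qed.

(** The sequences of one length over a finite type are finitely many; this supplies the fibre sums
    for regrouping along [size]. *)
Lemma has_sum_size (E : finType) (D : set (seq E)) (F : seq E -> C) n :
  has_sum (fun c => if size c == n then patch (fun=> 0) D F c else 0)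
    (\sum_(c \in D `&` [set c | size c = n]) F c).
Proof.
have finX := finite_setIr D (@finite_size E n).
rewrite fsbig_finite //.
rewrite (eq_big_seq (fun c => if size c == n then patch (fun=> 0) D F c else 0)).
  apply: has_sum_fset => c; rewrite in_fset_set // => cX; case: eqP => // cn.
  rewrite /patch; case: ifP => // cD; move: cX; rewrite in_setI cD => /negP[].
  by rewrite inE.
move=> c; rewrite in_fset_set // inE => -[Dc /= ->].
by rewrite eqxx /patch mem_set.
Qed.

End Trace.

(** * The fiber operator as a weighted adjacency matrix, and the domination of the cycle series *)

Section Graph.
Context {R : realType} {d : nat} (G : periodic_graph R d).
Local Notation C := (Cplx R).
Local Notation nm := (@Normc.normc R).
Local Notation E := (medge G).

Lemma tgt_rev (e : edge G) : tgt (Defs.rev e) = src e.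
Proof. by rewrite -src_rev Defs.revK. Qed.

Lemma ereprK (X : fedge G) : eproj (erepr X) = X.
Proof. by apply: val_inj; rewrite /= /erepr; case: cid. Qed.

Lemma eproj_shift u (e : edge G) : eproj (Defs.shift u e) = eproj e.
Proof.
apply: val_inj; apply/seteqP; split => z /= [v _ <-].
  by exists (v + u) => //; rewrite shiftD.
by exists (v - u) => //; rewrite -shiftD subrK.
Qed.

Definition frev (X : fedge G) : fedge G := eproj (Defs.rev (erepr X)).

(** Reversal commutes with the lattice action, so it descends to the quotient whatever the
    representative. *)
Lemma frev_eproj (e : edge G) : frev (eproj e) = eproj (Defs.rev e).
Proof. by rewrite /frev; have [u ->] := erepr_eproj e; rewrite rev_shift eproj_shift. Qed.

Lemma frevK : involutive frev.
Proof. by move=> X; rewrite /frev -/(frev _) frev_eproj Defs.revK ereprK. Qed.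

Lemma fsrc_frev X : fsrc (frev X) = ftgt X.
Proof.
rewrite fsrc_eproj; apply: (@vproj_shift _ _ _ _ _ _ _ 0).
by rewrite src_rev /lattice_vector raddf0 mul0mx addr0.
Qed.

Lemma ftgt_frev X : ftgt (frev X) = fsrc X.
Proof. by rewrite -{2}(frevK X) fsrc_frev. Qed.

Lemma findex_frev X : Defs.findex (frev X) = - Defs.findex X.
Proof. by rewrite findex_eproj /edge_index src_rev tgt_rev opprB. Qed.

Lemma pairing0 (k : d.-tuple R) : pairing 0 k = 0.
Proof. by rewrite /pairing big1 // => j _; rewrite mxE mul0r. Qed.

Lemma pairingD u v (k : d.-tuple R) : pairing (u + v) k = pairing u k + pairing v k.
Proof.
by rewrite /pairing -big_split; apply: eq_bigr => j _; rewrite mxE intrD mulrDl.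
Qed.

Lemma pairingN u (k : d.-tuple R) : pairing (- u) k = - pairing u k.
Proof. by apply/eqP; rewrite -addr_eq0 -pairingD addNr pairing0. Qed.

Variables (pot : 'rV[R]_d -> R).

(** Carrying the phase on each edge makes the product along a cycle equal to its weight times the
    phase of its total index. *)
Definition mphase (k : d.-tuple R) (e : E) : C :=
  (mweight pot e)%:C * expi (pairing (mindex e) k).

Lemma prod_mphase k (c : seq E) : \prod_(e <- c) mphase k e =
  (cycle_weight pot c)%:C * expi (pairing (cycle_index c) k).
Proof.
rewrite /cycle_weight /cycle_index; elim: c => [|e c IH].
  by rewrite !big_nil pairing0 expi0 mulr1.
by rewrite !big_cons IH pairingD expiD rmorphM mulrACA.
Qed.

(** The edges [inl] give the adjacency part; the loops [inr] have index 0 and contribute the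
    potential minus the degree, on the diagonal only. *)
Lemma fiber_schrodingerE k :
  fiber_schrodinger G pot k = walk_mx (@msrc _ _ G) (@mtgt _ _ G) (mphase k).
Proof.
apply/matrixP => i j; rewrite !mxE big_sumType /= -addrA; congr (_ + _).
  by apply: eq_bigr => X _; rewrite /mphase mul1r.
case: eqP => [<-|ij]; last first.
  rewrite !mulr0n oppr0 addr0 big_pred0 // => X.
  apply/negbTE/negP => /andP[/eqP Xi /eqP Xj].
  by apply: ij; apply: enum_val_inj; rewrite -Xi.
rewrite !mulr1n (big_pred1 (enum_val i)) => [|X]; last by rewrite /= andbb.
by rewrite /mphase pairing0 expi0 mulr1 addrC -rmorphB.
Qed.

Lemma conjc_mphase k e : conjc (mphase k e : R[i]) =
  (mweight pot e)%:C * expi (- pairing (mindex e) k).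
Proof. by rewrite -conjc_expi -[X in X * _]conjc_real -(rmorphM (@conjc R)). Qed.

Lemma fiber_schrodinger_conj k :
  (fiber_schrodinger G pot k)^T = map_mx (conjc : C -> C) (fiber_schrodinger G pot k).
Proof.
rewrite fiber_schrodingerE; apply/matrixP => i j; rewrite !mxE.
rewrite [RHS](rmorph_sum (@conjc R)).
(* Reversal exchanges the endpoints and negates the index, hence conjugates the phase; an added loop
   is its own inverse. *)
pose mrev (e : E) : E := match e with inl X => inl (frev X) | inr X => inr X end.
have mrevK : involutive mrev by case=> X //=; rewrite frevK.
rewrite (reindex_inj (inv_inj mrevK)).
apply: eq_big => [[X|X]|[X|X] _].
- by rewrite /= fsrc_frev ftgt_frev andbC.
- by rewrite /= andbC.
- apply: etrans _ (esym (conjc_mphase k (inl X))).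
  by rewrite -pairingN /mphase [mindex (mrev _)]findex_frev.
- apply: etrans _ (esym (conjc_mphase k (inr X))).
  by rewrite -pairingN /mphase /mrev [mindex _]/= oppr0.
Qed.

(** For positive [n] the nonemptiness required by [cycles] is automatic, and the sequences of length
    [n] are exactly the values of tuples. *)
Lemma cycle_sum_tuple n (F : seq E -> R) : (0 < n)%N ->
  \sum_(c \in cycles_of_size G n) F c =
  \sum_(u : n.-tuple E | path.cycle (fun e f => mtgt e == msrc f) u) F u.
Proof.
move=> n0; pose cyc := fun u : n.-tuple E => path.cycle (fun e f => mtgt e == msrc f) u.
have rP : [set` [seq val u | u <- enum cyc]] = cycles_of_size G n.
  apply/seteqP; split => c /=.
    case/mapP => u; rewrite mem_enum => ucyc ->.
    by split; [split|]; rewrite /= ?size_tuple.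
  move=> [[_ ccyc] cn]; apply/mapP; exists (tcast cn (in_tuple c)); rewrite ?val_tcast //.
  by rewrite mem_enum /in_mem /= /cyc val_tcast.
rewrite (fsbigE [seq val u | u <- enum cyc]).
- rewrite big_map big_enum_cond /=; apply: eq_bigl => u; rewrite andb_idr // => ucyc.
  by rewrite -rP inE /=; apply: map_f; rewrite mem_enum.
- by rewrite map_inj_uniq ?enum_uniq //; exact: val_inj.
- by rewrite rP.
- by move=> c; rewrite -rP /= => ->.
Qed.

Lemma tr_fiber_schrodingerX k n : (0 < n)%N ->
  \tr (fiber_schrodinger G pot k ^+ n) = (cycle_sum G pot n k)%:C.
Proof.
move=> n0; have := conj_tr_expr n (fiber_schrodinger_conj k).
(* A number equal to its conjugate is its own real part; taking real parts below then turns each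
   phase into a cosine. *)
set z := \tr _ => zJ; have -> : z = (complex.Re z)%:C.
  by case: {+}z zJ => a b [/eqP]; rewrite eqNr => /eqP ->.
congr (_%:C); rewrite /z fiber_schrodingerE /cycle_sum cycle_sum_tuple //.
case: n n0 {z zJ} => // n _.
rewrite tr_walk_mxX; rewrite (raddf_sum (@complex.Re R : Rcomplex R -> R)).
by apply: eq_bigr => u _; rewrite prod_mphase /= mul0r subr0.
Qed.

(** Its [n]-th power expands over all edge sequences of length [n], closed or not. *)
Definition weight_norm : R := \sum_(e : E) `|mweight pot e|.

(** The bound is proved over all edge sequences: those of length [n] together contribute at most the
    [n]-th term of the exponential series. *)
Lemma cycle_term_bounded (t : C) :
  sums_bounded (@cycle_term _ _ G pot t) (expR (weight_norm * nm t)).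
Proof.
move=> B; pose F c := nm (@cycle_term _ _ G pot t c).
have F0 c : 0 <= F c by exact: normc_ge0.
have FE c : F c = (\prod_(e <- c) `|mweight pot e|) * nm t ^+ size c / (size c)`!%:R.
  rewrite /F /cycle_term Normc.normcM normcX normc_real normrM normfV normr_nat.
  by rewrite -normr_prod mulrAC.
set N := (\max_(c <- B) size c).+1.
have tn0 : 0 <= weight_norm * nm t.
  by rewrite mulr_ge0 ?normc_ge0 //; apply: sumr_ge0.
apply: le_trans (exp_partial_sum_le N tn0).
(* [S c] hides [F c] in a double sum over lengths and tuples, where it occurs at [n = size c] and
   [u = c]; the order of summation can then be exchanged. *)
pose S c := \sum_(0 <= n < N) \sum_(u : n.-tuple E) if val u == c then F u else 0.
have S0 c n : 0 <= \sum_(u : n.-tuple E) if val u == c then F u else 0.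
  by apply: sumr_ge0 => u _; case: ifP.
apply: (@le_trans _ _ (\sum_(c <- B) S c)).
  rewrite big_seq [leRHS]big_seq; apply: ler_sum => c cB.
  have sizec : size c \in index_iota 0 N.
    rewrite mem_index_iota ltnS; exact: (@leq_bigmax_seq _ _ _ size).
  rewrite /S (bigD1_seq _ sizec (iota_uniq _ _)) /=.
  rewrite (bigD1 (in_tuple c)) //= eqxx -addrA lerDl addr_ge0 //.
    by apply: sumr_ge0 => u _; case: ifP.
  by apply: sumr_ge0 => n _; exact: S0.
rewrite /S exchange_big; apply: ler_sum => n _.
rewrite exchange_big exprMn -sum_tuple_prod !mulr_suml; apply: ler_sum => u _.
apply: (@le_trans _ _ (F u)); last by rewrite FE size_tuple.
(* A fixed tuple matches at most one element of [B]. *)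
case: (boolP (val u \in B)) => uB.
  rewrite (big_fsetD1 _ uB) /= eqxx big_seq big1 ?addr0 // => c.
  by rewrite !inE eq_sym => /andP[/negPf ->].
rewrite big_seq big1 // => c cB; case: eqP => // uc.
by rewrite uc cB in uB.
Qed.

End Graph.

(** * Integrals of cosines over the torus *)

Section TorusIntegral.
Context {R : realType}.
Local Notation RR := (measurableTypeR R).

Lemma measurable_torus_box d : measurable (@torus_box R d).
Proof.
rewrite (_ : torus_box =
    \bigcap_(j in [set: 'I_d]) ((fun k : d.-tuple RR => tnth k j) @^-1` `[0, 2 * pi])).
  apply: fin_bigcap_measurable => // j _; rewrite -[X in measurable X]setTI.
  exact: measurable_tnth.
apply/seteqP; split => k /= h j; first by move=> _; rewrite /= in_itv /= h.
by have := h j I; rewrite /= in_itv.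
Qed.

Lemma tuple_cons_torus_box d :
  tuple_cons @^-1` (@torus_box R d.+1) = `[0, 2 * pi] `*` (@torus_box R d).
Proof.
apply/seteqP; split => -[x k] /=.
  move=> h; split; first by have := h ord0; rewrite tnth0 /= in_itv.
  by move=> j; have := h (lift ord0 j); rewrite tnthS.
move=> [/= x01 h] j; case: (unliftP ord0 j) => [i|] ->; first by rewrite tnthS.
by rewrite tnth0; move: x01; rewrite in_itv.
Qed.

Lemma lebesgue_period : lebesgue_measure `[0 : R, 2 * pi] = (2 * pi)%:E.
Proof. by rewrite lebesgue_measure_itv /= lte_fin mulr_gt0 ?pi_gt0 // sube0. Qed.

Lemma lebesgue_torus_box d :
  lebesgue_tuple d (@torus_box R d) = ((2 * pi) ^+ d)%:E.
Proof.
elim: d => [|d IH] /=.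
  by rewrite diracE mem_set // => -[].
rewrite /cons_measure /pushforward tuple_cons_torus_box product_measure1E //.
  rewrite [X in (_ * X)%E]IH exprS EFinM; congr (_ * _)%E.
  exact: lebesgue_period.
exact: measurable_torus_box.
Qed.

Lemma measurable_pairing d (m : 'rV[int]_d) :
  measurable_fun [set: d.-tuple RR] (fun k => pairing m k : R).
Proof.
rewrite /pairing.
apply: measurable_sum => j; apply: measurable_funM; first exact: measurable_cst.
exact: measurable_tnth.
Qed.

Lemma measurable_cos_pairing d a (m : 'rV[int]_d) :
  measurable_fun [set: d.-tuple RR] (fun k => cos (a + pairing m k) : R).
Proof.
apply: measurableT_comp.
  by apply: continuous_measurable_fun; exact: continuous_cos.
by apply: measurable_funD; [exact: measurable_cst|exact: measurable_pairing].
Qed.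

Lemma integrable_torus_box d (f : d.-tuple RR -> R) M :
  measurable_fun [set: d.-tuple RR] f -> (forall k, `|f k| <= M) ->
  (lebesgue_tuple d).-integrable torus_box (EFin \o f).
Proof.
move=> mf fM; apply: measurable_bounded_integrable.
- exact: measurable_torus_box.
- by rewrite [X in (X < _)%E]lebesgue_torus_box ltry.
- exact: measurable_funTS.
- exists M; split; first exact: num_real.
  by move=> N MN k _; apply: le_trans (fM k) (ltW MN).
Qed.

(** For nonzero [m] the antiderivative [sin (a + m x) / m] takes the same value at both ends of the
    period. *)
Lemma integral_cos_period (a : R) (m : int) :
  (\int[lebesgue_measure]_(x in `[0%R, (2 * pi)%R]) (cos (a + m%:~R * x))%:E)%E =
  (if m == 0 then 2 * pi * cos a else 0)%:E.
Proof.
have pi2 : 0 < 2 * pi :> R by rewrite mulr_gt0 ?pi_gt0.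
case: eqP => [->|/eqP m0].
  under eq_integral do rewrite mul0r addr0.
  by rewrite integral_cst //= [X in (_ * X)%E]lebesgue_period -EFinM mulrC.
have mR : m%:~R != 0 :> R by rewrite intr_eq0.
pose F (x : R) : R := sin (a + m%:~R * x) / m%:~R.
have dF (x : R) : is_derive x (1 : R) F (cos (a + m%:~R * x)).
  have dlin : is_derive x (1 : R) (fun x : R => a + m%:~R * x) m%:~R.
    by apply: is_derive_eq; rewrite add0r mul1r /GRing.scale /= mulr1.
  have := @is_derive1_comp R sin (fun x => a + m%:~R * x) _ _ _ (is_derive_sin _) dlin.
  move=> /(is_deriveZ (m%:~R)^-1) /is_derive_eq.
  move=> /(_ (cos (a + m%:~R * x))) H.
  rewrite (_ : F = (m%:~R)^-1 *: (sin \o (fun x : R => a + m%:~R * x))).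
    by apply: H; rewrite /GRing.scale /= mulrC mulfK.
  by apply/funext => y; rewrite /F mulrC.
have cF x : {for x, continuous F}.
  by apply: differentiable_continuous; apply/derivable1_diffP; apply: ex_derive.
rewrite (@continuous_FTC2 _ _ F) //.
- rewrite /F -EFinB -mulrBl mulr0 addr0.
  rewrite (_ : sin (a + m%:~R * (2 * pi)) = sin a) ?subrr ?mul0r //.
  have -> : m%:~R * (2 * pi) = (pi *+ 2) *~ m :> R by rewrite [2 * pi]mulr_natl mulrzl.
  case: m {m0 mR F dF cF} => n; rewrite ?NegzE ?mulrNz -pmulrn.
    exact: periodicn (@sinD2pi R) n a.
  (* For negative [m], the subtracted periods are added back on the right-hand side. *)
  by rewrite -[in RHS](subrK (pi *+ 2 *+ n.+1) a) (periodicn (@sinD2pi R)).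
- apply: continuous_subspaceT => x.
  apply: continuous_comp; last exact: continuous_cos.
  apply: cvgD; first exact: cvg_cst.
  by apply: cvgM; [exact: cvg_cst|exact: cvg_id].
- split.
  + by move=> x _; exact: ex_derive.
  + exact/cvg_at_right_filter/cF.
  + exact/cvg_at_left_filter/cF.
- by move=> x _; rewrite derive1E; exact: derive_val.
Qed.

Lemma integral_cos_pairing d (a : R) (m : 'rV[int]_d) :
  (\int[lebesgue_tuple d]_(k in torus_box) (cos (a + pairing m k))%:E)%E =
  (if m == 0 then (2 * pi) ^+ d * cos a else 0)%:E.
Proof.
elim: d a m => [|d IH] a m.
  (* In dimension 0 the measure is the unit mass at the empty tuple, and the only [m] is 0. *)
  rewrite /= (integral_dirac _ (@measurable_torus_box 0)); last first.
    by apply/measurable_EFinP; apply: measurable_funTS; exact: measurable_cos_pairing.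
  rewrite diracE mem_set => [|[]//]; rewrite mul1e.
  rewrite /pairing big_ord0 addr0 expr0 mul1r.
  by rewrite ifT //; apply/eqP/rowP => -[].
pose m' : 'rV[int]_d := \row_j m 0 (lift ord0 j).
pose D : set (RR * d.-tuple RR) := `[0%R, (2 * pi)%R] `*` torus_box.
pose F (p : RR * d.-tuple RR) : \bar R := (cos (a + pairing m (tuple_cons p)))%:E.
have FE x k : F (x, k) = (cos (a + (m 0 ord0)%:~R * x + pairing m' k))%:E.
  rewrite /F /pairing big_ord_recl tnth0 addrA; congr (cos (_ + _))%:E.
  by apply: eq_bigr => j _; rewrite tnthS mxE.
have mD : measurable D by apply: measurableX => //; exact: measurable_torus_box.
have mF : measurable_fun setT
    (fun p : RR * d.-tuple RR => cos (a + pairing m (tuple_cons p)) : R).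
  apply: (measurableT_comp (measurable_cos_pairing a m)).
  exact: measurable_tuple_cons.
have iF : ((@lebesgue_measure R) \x (lebesgue_tuple d))%E.-integrable D F.
  apply: measurable_bounded_integrable => //.
  - have := lebesgue_torus_box d.+1.
    rewrite /= /cons_measure /pushforward tuple_cons_torus_box => ->.
    exact: ltry.
  - exact: measurable_funTS.
  - exists 1; split; first exact: num_real.
    by move=> N N1 p _; apply: le_trans (ltW N1); rewrite ler_norml cos_le1 cos_geN1.
have mcos : measurable_fun setT (fun k : d.+1.-tuple RR => (cos (a + pairing m k))%:E).
  by apply/measurable_EFinP; exact: measurable_cos_pairing.
have iF' : ((@lebesgue_measure R) \x (lebesgue_tuple d))%E.-integrable
    (tuple_cons @^-1` torus_box) ((fun k => (cos (a + pairing m k))%:E) \o tuple_cons).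
  by rewrite tuple_cons_torus_box.
rewrite /= /cons_measure.
rewrite (integral_pushforward (@measurable_tuple_cons R d) mcos iF'); last first.
  exact: measurable_torus_box.
(* Extension by zero puts the integral on the full product space, where Fubini applies. *)
rewrite tuple_cons_torus_box -/D integral_mkcond.
rewrite -integral12_prod_meas1; last first.
    exact: (iffLR (integrable_mkcond _ mD) iF).
(* For fixed [x], the induction hypothesis is used with the phase [a + m_0 x], where [m_0] is the
   first coordinate of [m]. *)
transitivity (\int[lebesgue_measure]_(x in `[0%R, (2 * pi)%R])
    (if m' == 0 then (2 * pi) ^+ d * cos (a + (m 0 ord0)%:~R * x) else 0)%:E)%E.
  rewrite [RHS]integral_mkcond; apply: eq_integral => x _.
  rewrite /fubini_F [RHS]/patch; case: ifPn => xD; last first.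
    apply: integral0_eq => k _; rewrite /patch ifN //; apply: contra xD.
    by rewrite !inE => -[].
  rewrite -IH [RHS]integral_mkcond; apply: eq_integral => k _.
  by rewrite /patch -FE in_setX xD.
have -> : (m == 0) = (m' == 0) && (m 0 ord0 == 0).
  apply/eqP/andP => [m0|[/eqP m'0 /eqP m0]].
    by split; [apply/eqP/rowP => j|]; rewrite ?mxE m0 mxE.
  apply/rowP => j; rewrite mxE; case: (unliftP ord0 j) => [i|] -> //.
  by move/rowP: m'0 => /(_ i); rewrite !mxE.
case: (m' == 0) => /=; last by rewrite integral0_eq.
under eq_integral do rewrite EFinM.
rewrite integralZl //; last first.
  apply: measurable_bounded_integrable => //.
  - by rewrite [X in (X < _)%E]lebesgue_period ltry.
  - apply: measurable_funTS; apply: continuous_measurable_fun => x.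
    apply: continuous_comp; last exact: continuous_cos.
    apply: cvgD; first exact: cvg_cst.
    by apply: cvgM; [exact: cvg_cst|exact: cvg_id].
  - exists 1; split; first exact: num_real.
    by move=> N N1 p _; apply: le_trans (ltW N1); rewrite ler_norml cos_le1 cos_geN1.
rewrite integral_cos_period -EFinM; case: ifP => _; last by rewrite mulr0.
by rewrite mulrA -exprSr.
Qed.

End TorusIntegral.

(** * Calculus of integrals over the period box *)

Section BoxIntegral.
Context {R : realType} {d : nat}.
Local Notation RR := (measurableTypeR R).
Implicit Types (f g : d.-tuple RR -> R).

(** Measurability and integrability travel with the value, so finite linear combinations can be
    integrated without side conditions. *)
Definition has_box_integral f (v : R) :=
  [/\ measurable_fun [set: d.-tuple RR] f,
      (lebesgue_tuple d).-integrable torus_box (EFin \o f) &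
      (\int[lebesgue_tuple d]_(k in torus_box) (f k)%:E)%E = v%:E].

Lemma has_box_integral_cos (m : 'rV[int]_d) :
  has_box_integral (fun k => cos (pairing m k))
    (if m == 0 then (2 * pi) ^+ d else 0).
Proof.
have cosE : (fun k : d.-tuple RR => cos (pairing m k)) =
    (fun k : d.-tuple RR => cos (0 + pairing m k)).
  by apply/funext => k; rewrite add0r.
have mcos := measurable_cos_pairing (0 : R) m; rewrite cosE; split => //.
  apply: (@integrable_torus_box _ _ _ 1 mcos) => k.
  by rewrite ler_norml cos_le1 cos_geN1.
by rewrite integral_cos_pairing cos0 mulr1.
Qed.

Lemma has_box_integralZ f v (a : R) :
  has_box_integral f v -> has_box_integral (fun k => a * f k) (a * v).
Proof.
move=> [mf intf fv]; have mB := @measurable_torus_box R d; split.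
- by apply: measurable_funM => //; exact: measurable_cst.
- exact: (integrableZl mB a intf).
- by under eq_integral do rewrite EFinM; rewrite (integralZl mB intf) fv -EFinM.
Qed.

Lemma has_box_integralD f g v w : has_box_integral f v ->
  has_box_integral g w -> has_box_integral (fun k => f k + g k) (v + w).
Proof.
move=> [mf intf fv] [mg intg gw]; have mB := @measurable_torus_box R d; split.
- exact: measurable_funD.
- exact: (integrableD mB intf intg).
- under eq_integral do rewrite EFinD.
  by rewrite (integralD mB intf intg) fv gw -EFinD.
Qed.

Lemma has_box_integral_cst (a : R) : has_box_integral (fun=> a) ((2 * pi) ^+ d * a).
Proof.
have := has_box_integralZ a (has_box_integral_cos 0); rewrite eqxx mulrC.
by under eq_fun do rewrite pairing0 cos0 mulr1.
Qed.

Lemma has_box_integral_sum (I : Type) (r : seq I) (f : I -> d.-tuple RR -> R) v :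
  (forall i, has_box_integral (f i) (v i)) ->
  has_box_integral (fun k => \sum_(i <- r) f i k) (\sum_(i <- r) v i).
Proof.
move=> fv; elim: r => [|i r IH].
  rewrite big_nil -[X in has_box_integral _ X](mulr0 ((2 * pi) ^+ d)).
  by under eq_fun do rewrite big_nil; exact: has_box_integral_cst.
rewrite big_cons; under eq_fun do rewrite big_cons.
exact: has_box_integralD.
Qed.

(** Dominated convergence with a constant majorant, integrable because the box has finite
    measure. *)
Lemma has_box_integral_lim (f : nat -> d.-tuple RR -> R) v F M :
  (forall N, has_box_integral (f N) (v N)) -> (forall N k, `|f N k| <= M) ->
  (forall k, (fun N => f N k) @ \oo --> F k) ->
  (lebesgue_tuple d).-integrable torus_box (EFin \o F) /\
  v @ \oo --> \int[lebesgue_tuple d]_(k in torus_box) F k.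
Proof.
move=> fv fM fF; have mB := @measurable_torus_box R d.
have mf N : measurable_fun torus_box (EFin \o f N).
  by have [mf _ _] := fv N; apply/measurable_EFinP/measurable_funTS.
have mF : measurable_fun torus_box (EFin \o F).
  apply/measurable_EFinP; apply: (measurable_fun_cvg (h := f)) => [N|k _].
    by have [mfN _ _] := fv N; exact: measurable_funTS.
  exact: fF.
have [|||intF _ cvgF] := @dominated_convergence _ _ _ (lebesgue_tuple d) _ mB
  (fun N => EFin \o f N) (EFin \o F) (cst M%:E) mf mF.
- by apply: aeW => k _; apply: cvg_EFin; [exact: nearW|exact: fF].
- by have [_ + _] := has_box_integral_cst M.
- by apply: aeW => k N _; rewrite /= lee_fin.
split=> //; rewrite /Rintegral.
(* Reading [v] as the finite part of extended real integrals brings the convergence back to [R]. *)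
have vE : v = fine \o (fun N => (\int[lebesgue_tuple d]_(k in torus_box) (f N k)%:E)%E).
  by apply/funext => N /=; have [_ _ ->] := fv N.
rewrite vE; apply: fine_cvg; rewrite fineK //.
exact: integrable_fin_num intF.
Qed.

End BoxIntegral.

Lemma expr_scalemx (K : comPzRingType) n (a : K) (A : 'M[K]_n) m :
  (a *: A) ^+ m = a ^+ m *: A ^+ m.
Proof.
elim: m => [|m IH]; first by rewrite !expr0 scale1r.
by rewrite !exprS -!mulmxE IH -scalemxAl -scalemxAr scalerA.
Qed.

(** * The expansions of the heat trace and its mean over the torus *)

Section HeatTrace.
Context {R : realType} {d : nat} (G : periodic_graph R d) (pot : 'rV[R]_d -> R).
Context (t : Cplx R).
Local Notation C := (Cplx R).
Local Notation nm := (@Normc.normc R).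
Local Notation RR := (measurableTypeR R).
Local Notation E := (medge G).
Local Notation M := (expR (weight_norm G pot * nm t)).

Let nu : C := #|{: fvertex G}|%:R.
Let n_term (k : d.-tuple R) (n : nat) : C :=
  t ^+ n / n`!%:R * (cycle_sum G pot n k)%:C.
Let c_term (k : d.-tuple R) (c : seq E) : C :=
  cycle_term pot t c * (cos (pairing (cycle_index c) k))%:C.
Let m_term (k : d.-tuple R) (m : 'rV[int]_d) : C :=
  heat_coef G pot t m * (cos (pairing m k))%:C.
Let n_term0 (n : nat) : C := t ^+ n / n`!%:R * (cycle_sum0 G pot n)%:C.

Lemma cos_term_bounded (g : seq E -> R) :
  sums_bounded (fun c => @cycle_term _ _ G pot t c * (cos (g c))%:C) M.
Proof.
apply: le_sums_bounded (cycle_term_bounded pot t) => c.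
rewrite Normc.normcM ler_piMr ?normc_ge0 // normc_real.
by rewrite ler_norml cos_le1 cos_geN1.
Qed.

Lemma finite_cycles_of_size n (D : set (seq E)) :
  finite_set (cycles_of_size G n `&` D).
Proof.
apply: finite_setIl; apply: finite_setIr; exact: finite_size.
Qed.

(** Serves both series over lengths: all cycles with [g] the cosine, and the cycles of index 0 with
    [g] equal to 1. *)
Lemma sum_cycle_term (n : nat) (D : set (seq E)) (g : seq E -> R) :
  D `<=` cycles G ->
  \sum_(c \in D `&` [set c | size c = n])
      (@cycle_term _ _ G pot t c * (g c)%:C : C) =
  t ^+ n / n`!%:R *
  (\sum_(c \in cycles_of_size G n `&` D) cycle_weight pot c * g c)%:C.
Proof.
move=> DG; have -> : D `&` [set c | size c = n] = cycles_of_size G n `&` D.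
  apply/seteqP; split=> c; last by case=> -[_ cn] Dc.
  by move=> [Dc cn]; split=> //; split=> //; exact: DG.
have finX := finite_cycles_of_size n D.
rewrite !fsbig_finite //= rmorph_sum mulr_sumr; apply: eq_big_seq => c.
rewrite in_fset_set // inE => -[[_ /= cn] _].
rewrite /cycle_term cn !rmorphM /= fmorphV rmorph_nat.
by rewrite [_ * t ^+ n]mulrC [_%:C / _]mulrC !mulrA.
Qed.

Lemma n_term_fibre k n :
  has_sum (fun c => if size c == n
                    then patch (fun=> 0) (cycles G) (c_term k) c else 0)
    (n_term k n).
Proof.
have := has_sum_size (cycles G) (c_term k) n; congr has_sum.
by rewrite sum_cycle_term // /n_term /cycle_sum setIidl // => c [].
Qed.

Lemma n_term0_fibre n :
  has_sum (fun c => if size c == n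
      then patch (fun=> 0) (cycles_of_index G 0) (cycle_term pot t) c else 0)
    (n_term0 n).
Proof.
have := has_sum_size (cycles_of_index G 0) (cycle_term pot t) n; congr has_sum.
have -> : n_term0 n = t ^+ n / n`!%:R *
    (\sum_(c \in cycles_of_size G n `&` cycles_of_index G 0) cycle_weight pot c * 1)%:C.
  by congr (_ * _%:C); apply: eq_fsbigr => c _; rewrite mulr1.
rewrite -sum_cycle_term; last by move=> c [].
by apply: eq_fsbigr => c _; rewrite mulr1.
Qed.

Lemma has_sum_cycles k :
  exists s, has_sum (patch (fun=> 0) (cycles G) (c_term k)) s.
Proof.
by apply: has_sum_exists; apply: sums_bounded_patch; exact: cos_term_bounded.
Qed.

Lemma has_sum_heat_coef m :
  has_sum (patch (fun=> 0) (cycles_of_index G m) (cycle_term pot t))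
    (heat_coef G pot t m).
Proof.
have [s hs] := has_sum_exists
  (sums_bounded_patch (cycles_of_index G m) (cycle_term_bounded (G := G) pot t)).
by rewrite /heat_coef (sum_over_has_sum hs).
Qed.

(** On a fibre of [cycle_index] the cosine is constant and factors out; what remains is the possibly
    infinite sum [heat_coef]. *)
Lemma m_term_fibre k m :
  has_sum (fun c => if cycle_index c == m
                    then patch (fun=> 0) (cycles G) (c_term k) c else 0)
    (m_term k m).
Proof.
rewrite /m_term mulrC.
apply: eq_has_sum (has_sumZ (cos (pairing m k))%:C (has_sum_heat_coef m)) => c.
rewrite /patch /cycles_of_index in_setI.
case: (boolP (c \in cycles G)) => cG /=; last by rewrite mulr0 if_same.
have [<-|cm] := eqVneq (cycle_index c) m; first by rewrite mem_set // mulrC.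
by rewrite memNset ?mulr0 //=; apply/eqP.
Qed.

(** The bound is uniform in [k], as dominated convergence will require. *)
Lemma n_term_bounded k : sums_bounded (n_term k) M.
Proof.
apply: (sums_bounded_fibres (n_term_fibre k)).
by apply: sums_bounded_patch; exact: cos_term_bounded.
Qed.

Lemma n_term0_bounded : sums_bounded n_term0 M.
Proof.
apply: (sums_bounded_fibres n_term0_fibre).
by apply: sums_bounded_patch; exact: cycle_term_bounded.
Qed.

Lemma m_term_bounded k : sums_bounded (m_term k) M.
Proof.
apply: (sums_bounded_fibres (m_term_fibre k)).
by apply: sums_bounded_patch; exact: cos_term_bounded.
Qed.

(** The constant [nu] is the term of order 0, the trace of the identity; the cycle series
    contributes nothing there because cycles are nonempty. *)
Lemma heat_trace_expansion k s :
  has_sum (n_term k) s -> heat_trace G pot t k = nu + s.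
Proof.
move=> hs; have h0 : has_sum (fun n : nat => if n == 0%N then nu else 0 : C) nu.
  have := @has_sum_fset R nat (fun n => if n == 0%N then nu else 0) [fset 0%N]%fset.
  by rewrite big_seq_fset1 /=; apply=> n; rewrite inE; case: eqP.
apply: has_sum_unique (has_sum_tr_mexp _) _.
apply: eq_has_sum (has_sumD h0 hs) => -[|n] /=.
  rewrite !expr0 mxtrace1 fact0 invr1 mul1r /n_term.
  rewrite (_ : cycle_sum G pot 0 k = 0) ?mulr0 ?addr0 //.
  by rewrite /cycle_sum fsbig1 // => c [[c0 _] /= c00]; rewrite c00 in c0.
rewrite add0r expr_scalemx mxtraceZ tr_fiber_schrodingerX // /n_term.
by rewrite mulrA [_^-1 * _]mulrC.
Qed.

Lemma cycles_of_size0 : cycles_of_size G 0 = set0.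
Proof. by apply/seteqP; split=> c // [[c0 _] /= c00]; rewrite c00 in c0. Qed.

Lemma n_term_at0 k : n_term k 0 = 0.
Proof. by rewrite /n_term /cycle_sum cycles_of_size0 fsbig_set0 mulr0. Qed.

Lemma n_term0_at0 : n_term0 0 = 0.
Proof. by rewrite /n_term0 /cycle_sum0 cycles_of_size0 set0I fsbig_set0 mulr0. Qed.

(** Integrating the finite sum term by term leaves only the cycles of index 0. *)
Lemma has_box_integral_cycle_sum n :
  has_box_integral (cycle_sum G pot n : d.-tuple RR -> R)
    ((2 * pi) ^+ d * cycle_sum0 G pot n).
Proof.
have finX : finite_set (cycles_of_size G n).
  by rewrite -[cycles_of_size G n]setIT; exact: finite_cycles_of_size.
have -> : (cycle_sum G pot n : d.-tuple RR -> R) =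
    fun k => \sum_(c <- fset_set (cycles_of_size G n))
               cycle_weight pot c * cos (pairing (cycle_index c) k).
  by apply/funext => k; rewrite /cycle_sum fsbig_finite.
have -> : (2 * pi) ^+ d * cycle_sum0 G pot n =
    \sum_(c <- fset_set (cycles_of_size G n))
      cycle_weight pot c * (if cycle_index c == 0 then (2 * pi) ^+ d else 0).
  have fin0 := finite_cycles_of_size n (cycles_of_index G 0).
  rewrite /cycle_sum0 fsbig_finite //= mulr_sumr.
  under [RHS]eq_bigr do rewrite mulrC (fun_if ( *%R^~ _)) mul0r.
  rewrite -[RHS]big_mkcond -[RHS]big_filter; apply: perm_big.
  apply: uniq_perm; [exact: fset_uniq|exact/filter_uniq/fset_uniq|move=> c].
  rewrite mem_filter !in_fset_set //; apply/idP/andP.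
    by rewrite inE => -[cn [_ /= c0]]; rewrite inE c0.
  by rewrite !inE => -[/eqP c0 cn]; split=> //; split=> //; case: cn.
apply: has_box_integral_sum => c; apply: has_box_integralZ.
exact: has_box_integral_cos.
Qed.

(* [phi] is the real or the imaginary part. *)
Section Part.
Context (phi : C -> R).
Hypothesis phiD : forall x y, phi (x + y) = phi x + phi y.
Hypothesis phiMr : forall x (a : R), phi (x * a%:C) = phi x * a.
Hypothesis phi_le : forall x, `|phi x| <= nm x.

(** The partial sums over lengths have exactly known integrals [v N]. These converge to the integral
    of the heat trace by domination and to the right-hand side by [hs0], so the two limits agree. *)
Lemma torus_integral_part s0 : has_sum n_term0 s0 ->
  (lebesgue_tuple d).-integrable torus_box
    (EFin \o (fun k => phi (heat_trace G pot t k))) /\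
  (\int[lebesgue_tuple d]_(k in torus_box) phi (heat_trace G pot t k)) =
    (2 * pi) ^+ d * phi (nu + s0).
Proof.
move=> hs0.
have phi0 : phi 0 = 0 by apply: (addrI (phi 0)); rewrite -phiD !addr0.
have phi_sum (r : seq nat) (F : nat -> C) :
    phi (\sum_(n <- r) F n) = \sum_(n <- r) phi (F n).
  by elim/big_rec2: _ => // n y x _ <-; rewrite phiD.
have phiB x y : phi (x - y) = phi x - phi y.
  by apply: (addIr (phi y)); rewrite -phiD !subrK.
(* Being additive and bounded by the modulus, [phi] is continuous. *)
have phi_cvg (u : nat -> C) l : u @ \oo --> l -> (fun N => phi (u N)) @ \oo --> phi l.
  move=> /cvgrPdist_lt ul; apply/cvgrPdist_lt => e e0.
  have /ul : 0 < e%:C :> C by rewrite (ltcR 0).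
  apply: filterS => N; rewrite norm_normcE ltcR -phiB; exact: le_lt_trans.
pose f N (k : d.-tuple RR) :=
  phi nu + \sum_(1 <= n < N) phi (t ^+ n / n`!%:R) * cycle_sum G pot n k.
pose v N := (2 * pi) ^+ d * phi nu +
  \sum_(1 <= n < N) phi (t ^+ n / n`!%:R) * ((2 * pi) ^+ d * cycle_sum0 G pot n).
have fE N k : f N k = phi (nu + \sum_(1 <= n < N) n_term k n).
  by rewrite phiD phi_sum; congr (_ + _); apply: eq_bigr => n _; rewrite phiMr.
have vE N : v N = (2 * pi) ^+ d * phi (nu + \sum_(1 <= n < N) n_term0 n).
  rewrite phiD phi_sum mulrDr mulr_sumr; congr (_ + _).
  by apply: eq_bigr => n _; rewrite phiMr mulrCA.
have fv N : has_box_integral (f N) (v N).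
  apply: has_box_integralD; first exact: has_box_integral_cst.
  by apply: has_box_integral_sum => n; exact/has_box_integralZ/has_box_integral_cycle_sum.
have fM N k : `|f N k| <= nm nu + M.
  rewrite fE; apply: le_trans (phi_le _) _; apply: le_trans (le_normcD _ _) _.
  rewrite lerD2l; apply: le_trans (normc_sum _ _ _) _.
  have := n_term_bounded k [fset n in index_iota 1 N]%fset; apply: le_trans.
  rewrite le_eqVlt; apply/orP; left; apply/eqP; apply: perm_big.
  apply: uniq_perm; [exact: iota_uniq|exact: fset_uniq|].
  by move=> n; rewrite !inE.
have fF k : (fun N => f N k) @ \oo --> phi (heat_trace G pot t k).
  have [s /(has_sum_fibres (n_term_fibre k)) hs] := has_sum_cycles k.
  rewrite (heat_trace_expansion hs); under eq_fun do rewrite fE.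
  apply: phi_cvg; apply: cvgD; first exact: cvg_cst.
  exact: cvg_sums_from1 (n_term_at0 k) hs.
have [intF cvgF] := has_box_integral_lim fv fM fF; split=> //.
apply: (cvg_unique _ cvgF) => //.
have -> : v = fun N => (2 * pi) ^+ d * phi (nu + \sum_(1 <= n < N) n_term0 n).
  by apply/funext.
apply: cvgM; first exact: cvg_cst.
apply: phi_cvg; apply: cvgD; first exact: cvg_cst.
exact: cvg_sums_from1 n_term0_at0 hs0.
Qed.

End Part.

Lemma torus_integral_heat_trace s0 : has_sum n_term0 s0 ->
  torus_integrable (heat_trace G pot t) /\
  (((2 * pi) ^+ d)^-1)%:C * torus_integral (heat_trace G pot t) = nu + s0.
Proof.
move=> hs0.
have [||intRe eRe] := @torus_integral_part (@complex.Re R) _ _ (@normc_Re R) s0 hs0.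
- by move=> [a b] [a' b'].
- by move=> [a b] x /=; rewrite mulr0 subr0.
have [||intIm eIm] := @torus_integral_part (@complex.Im R) _ _ (@normc_Im R) s0 hs0.
- by move=> [a b] [a' b'].
- by move=> [a b] x /=; rewrite mulr0 add0r.
split; first by split.
have pi0 : (2 * pi) ^+ d != 0 :> R by rewrite expf_neq0 // mulf_neq0 // gt_eqF // pi_gt0.
rewrite /torus_integral eRe eIm.
by case: (nu + s0) => a b; simpc; rewrite !mulKf.
Qed.

End HeatTrace.

Theorem corollary2p7 (R : realType) (d : nat) (G : periodic_graph R d)
    (pot : 'rV[R]_d -> R) (pot_periodic : periodic_potential G pot)
    (t : Cplx R) :
  let nu : Cplx R := #|{: fvertex G}|%:R in
  let n_term (k : d.-tuple R) (n : nat) : Cplx R :=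
    t ^+ n / n`!%:R * (cycle_sum G pot n k)%:C in
  let c_term (k : d.-tuple R) (c : seq (medge G)) : Cplx R :=
    cycle_term pot t c * (cos (pairing (cycle_index c) k))%:C in
  let m_term (k : d.-tuple R) (m : 'rV[int]_d) : Cplx R :=
    heat_coef G pot t m * (cos (pairing m k))%:C in
  let n_term0 (n : nat) : Cplx R := t ^+ n / n`!%:R * (cycle_sum0 G pot n)%:C in
  [/\ (forall k : d.-tuple R,
        [/\ abs_summable [set n | (1 <= n)%N] (n_term k),
            abs_summable (cycles G) (c_term k),
            heat_trace G pot t k = nu + limn (fun N => \sum_(1 <= n < N) n_term k n) &
            heat_trace G pot t k = nu + sum_over (cycles G) (c_term k)]),
      (forall m : 'rV[int]_d,
        abs_summable (cycles_of_index G m) (cycle_term pot t)),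
      (forall k : d.-tuple R,
        abs_summable [set: 'rV[int]_d] (m_term k) /\
        heat_trace G pot t k = nu + sum_over [set: 'rV[int]_d] (m_term k)) &
      [/\ abs_summable [set n | (1 <= n)%N] n_term0,
          torus_integrable (heat_trace G pot t),
          (((2 * pi) ^+ d)^-1)%:C * torus_integral (heat_trace G pot t) =
            nu + limn (fun N => \sum_(1 <= n < N) n_term0 n) &
          (((2 * pi) ^+ d)^-1)%:C * torus_integral (heat_trace G pot t) =
            nu + sum_over (cycles_of_index G 0) (cycle_term pot t)]].
Proof.
move=> nu n_term c_term m_term n_term0.
(* One value [s0] serves both formulas for the mean: it sums the cycles of index 0 and, after
   regrouping by length, the series over [n]. *)
have [s0 hs0] := has_sum_exists
  (sums_bounded_patch (cycles_of_index G 0) (cycle_term_bounded (G := G) pot t)).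
have hn0 := has_sum_fibres (n_term0_fibre G pot t) hs0.
have [intH intE] := torus_integral_heat_trace hn0.
split.
- move=> k; have [s hs] := has_sum_cycles G pot t k.
  have hn := has_sum_fibres (n_term_fibre G pot t k) hs.
  have HE := heat_trace_expansion hn.
  split.
  + exact (abs_summable_bounded _ (n_term_bounded G pot t k)).
  + exact (abs_summable_bounded _ (cos_term_bounded pot t _)).
  + by rewrite HE (limn_sums_from1 (n_term_at0 G pot t k) hn).
  + by rewrite HE (sum_over_has_sum hs).
- by move=> m; exact (abs_summable_bounded _ (cycle_term_bounded pot t)).
- move=> k; have [s hs] := has_sum_cycles G pot t k.
  split; first exact (abs_summable_bounded _ (m_term_bounded G pot t k)).
  (* The value [s] obtained by grouping by length is also the value obtained by grouping by
     index. *)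
  rewrite (heat_trace_expansion (has_sum_fibres (n_term_fibre G pot t k) hs)).
  congr (_ + _); apply/esym/sum_over_has_sum; rewrite patch_setT.
  exact (has_sum_fibres (m_term_fibre G pot t k) hs).
- split=> //.
  + exact (abs_summable_bounded _ (n_term0_bounded G pot t)).
  + by rewrite intE (limn_sums_from1 (n_term0_at0 G pot t) hn0).
  + by rewrite intE (sum_over_has_sum hs0).
Qed.
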